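(* Let $n\ge 2$ be an integer, $k,c_b>0$, $\rho_0>0$, and let $\lambda_{1,0},\dots,\lambda_{n,0}$ be real numbers with $\lambda_{1,0}=\cdots=\lambda_{J,0}<\lambda_{J+1,0}\le\cdots\le\lambda_{n,0}$ for some integer $1\le J\le n$. If $J>\frac n2$, or if $J\ge3$ and $J=\frac n2$, then the system $$\lambda_i'=-\lambda_i^2+\frac{k}{n}(\rho-c_b)\ (i=1,\dots,n),\qquad \rho'=-\rho\lambda,\quad \lambda=\sum_{i=1}^n\lambda_i,\qquad \rho(0)=\rho_0,\ \lambda_i(0)=\lambda_{i,0},$$ has a global (defined for all $t\ge0$) bounded solution.
   Context: When $J=n$ the condition on the initial data reads $\lambda_{1,0}=\cdots=\lambda_{n,0}$. *)

(* Defs.v *)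
From HB Require Import structures.
From mathcomp Require Import all_boot all_order all_algebra.
From mathcomp Require Import all_classical all_reals all_analysis.
Set Implicit Arguments. Unset Strict Implicit. Unset Printing Implicit Defensive.
Import Order.TTheory GRing.Theory Num.Theory.
Import numFieldNormedType.Exports.
Local Open Scope ring_scope.
Local Open Scope classical_set_scope.

(* Indices are 0-based: lam i for i < n stands for lambda_{i+1}.
   A (classical) solution on [0, +oo) of
     lam_i' = - lam_i^2 + (k/n) (rho - cb),   rho' = - rho * sum_i lam_i :
   differentiable on (0,+oo) with the equations there, and right-continuous at 0. *)
Definition ode_solution (R : realType) (n : nat) (k cb : R)
    (lam : nat -> R -> R) (rho : R -> R) : Prop :=
  (forall t : R, 0 < t ->
     (forall i, (i < n)%N ->
        is_derive t 1 (lam i) (- (lam i t) ^+ 2 + k / n%:R * (rho t - cb)))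
     /\ is_derive t 1 rho (- rho t * \sum_(i < n) lam i t))
  /\ (forall i, (i < n)%N -> lam i x @[x --> 0^'+] --> lam i 0)
  /\ (rho x @[x --> 0^'+] --> rho 0).

(* Main.v *)
(* Put u_i = expR (integral of lam_i). All u_i solve the same linear equation
   u'' = kap (rho - cb) u with kap = k/n, and rho = rho0 / prod u_i.

   The geometric mean y of the u_i satisfies
     y'' = kap (rho0 y^(1-n) - cb y) - psi y^(-3),  psi = y^4 Var(lam),
   where psi' = -2 y^4 M3 and M3 is the third central moment of the lam_i.
   If at least half of the lam_i equal their minimum then M3 >= 0, so psi
   decreases. The energy E of this equation has E' = y^2 M3 = - psi' y^(-2) / 2,
   and for n >= 5 the repulsive term y^(2-n) dominates y^(-2), so Gronwall's
   inequality with the weight psi bounds E, hence y, 1/y and all lam_i.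

   For n = 3, 4 at most one lam_i differs from the others, and there is a family
   of energies, for y_b = u_1^(1-b) u_n^b. The one with b = 0 decreases; for n = 3
   it makes the one with a small b > 0 decrease as well. This gives
   (lam_n - lam_1)^2 <= C (u_1/u_n)^eps rho, which replaces the domination used
   above in the Gronwall argument for b = 1/n. For n = 2 the energy is conserved.

   Existence: clamping the field makes it bounded and globally Lipschitz, and the
   a priori bound shows that the solution never reaches the clamped region. *)
Require Import Defs.
From HB Require Import structures.
From mathcomp Require Import all_boot all_order all_algebra.
From mathcomp Require Import all_classical all_reals all_analysis.
From mathcomp Require Import ring lra zify.
Import Order.TTheory GRing.Theory Num.Theory.
Import numFieldNormedType.Exports.
Local Open Scope ring_scope.

(** * Calculus on the line: derivative rules, comparison of increments, antiderivatives *)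

Lemma is_deriveDf {R : realType} {f g : R -> R} {x a b : R} :
  is_derive x 1 f a -> is_derive x 1 g b ->
  is_derive x 1 (fun t => f t + g t) (a + b).
Proof. by move=> fa gb; exact: is_deriveD. Qed.

Lemma is_deriveNf {R : realType} {f : R -> R} {x a : R} :
  is_derive x 1 f a -> is_derive x 1 (fun t => - f t) (- a).
Proof. by move=> fa; exact: is_deriveN. Qed.

Lemma is_deriveMf {R : realType} {f g : R -> R} {x a b : R} :
  is_derive x 1 f a -> is_derive x 1 g b ->
  is_derive x 1 (fun t => f t * g t) (a * g x + f x * b).
Proof.
move=> fa gb; apply: (is_derive_eq (is_deriveM fa gb)).
by rewrite addrC; congr (_ + _); exact: mulrC.
Qed.

Lemma is_derive_expf {R : realType} {f : R -> R} {x a : R} :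
  is_derive x 1 f a -> is_derive x 1 (fun t => expR (f t)) (expR (f x) * a).
Proof.
move=> fa.
exact: (is_derive1_comp (is_derive_expR (f x)) fa).
Qed.

Lemma is_derive_constf {R : realType} (c x : R) : is_derive x 1 (fun=> c) 0.
Proof. exact: is_derive_cst. Qed.

Lemma is_derive_continuous {R : realType} {f : R -> R} {x a : R} :
  is_derive x 1 f a -> {for x, continuous f}.
Proof.
by move=> fa; apply: differentiable_continuous; apply/derivable1_diffP; case: fa.
Qed.

Lemma is_derive_le {R : realType} (f df : R -> R) (a b : R) :
  a <= b -> (forall t, a <= t <= b -> is_derive t 1 f (df t)) ->
  (forall t, a <= t <= b -> df t <= 0) -> f b <= f a.
Proof.
move=> ab dfE df0.
have [||c /[!in_itv]/= cab E] := @MVT_segment R f df a b ab.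
- by move=> t /[!in_itv]/= /andP[at_ tb]; apply: dfE; rewrite !ltW.
- apply: continuous_in_subspaceT => t /[!inE]/=; rewrite in_itv/= => tab.
  exact: is_derive_continuous (dfE t tab).
by rewrite -subr_le0 E mulr_le0_ge0 ?df0 ?subr_ge0.
Qed.

Lemma is_derive0_const {R : realType} (f : R -> R) (a b : R) :
  a <= b -> (forall t, a <= t <= b -> is_derive t 1 f 0) -> f b = f a.
Proof.
move=> ab df; apply/le_anti/andP; split.
  exact: (is_derive_le _ (fun=> 0)).
rewrite -lerN2; apply: (is_derive_le (fun t => - f t) (fun=> 0)) => // t tab.
by rewrite -oppr0; apply/is_deriveNf/df.
Qed.

Lemma is_derive_abs_le {R : realType} (f df g dg : R -> R) (a b : R) :
  a <= b -> (forall t, a <= t <= b -> is_derive t 1 f (df t)) ->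
  (forall t, a <= t <= b -> is_derive t 1 g (dg t)) ->
  (forall t, a <= t <= b -> `|df t| <= dg t) ->
  `|f b - f a| <= g b - g a.
Proof.
move=> ab dfE dgE dfg.
(* For either sign [s], the function [s * f - g] is nonincreasing; the signs 1 and -1 together give
   the absolute value. *)
have H (s : R) : `|s| = 1 -> s * (f b - f a) <= g b - g a.
  move=> s1.
  have : s * f b + - g b <= s * f a + - g a.
    apply: (is_derive_le (fun t => s * f t + - g t)
             (fun t => (0 * f t + s * df t) + - dg t)) => // t tab.
      by apply/is_deriveDf/is_deriveNf/dgE => //; apply: is_deriveMf (dfE t tab).
    rewrite mul0r add0r subr_le0 (le_trans _ (dfg t tab))//.
    by rewrite (le_trans (ler_norm _))// normrM s1 mul1r.
  lra.
have := H 1 (normr1 _); have := H (-1) (normrN1 _).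
by rewrite mul1r mulN1r ler_norml => ? ?; apply/andP; split; lra.
Qed.

(* Precomposing with the absolute value makes the derivative two-sided at 0. *)
Lemma antiderivative {R : realType} (f : R -> R) :
  (forall t : R, 0 <= t -> {for t, continuous f}) ->
  exists G : R -> R, G 0 = 0 /\ forall t : R, 0 <= t -> is_derive t 1 G (f t).
Proof.
move=> cf; pose g (t : R) := f `|t|.
have cg : continuous g.
  move=> t; apply: continuous_comp; first exact: norm_continuous.
  exact: cf.
pose mu := @lebesgue_measure R.
pose F (y : R) := (\int[mu]_(t in [set` `[-1, y]]) g t).
exists (fun t => F t - F 0); split; first by rewrite subrr.
move=> t t0.
have gi : mu.-integrable `[-1, (t + 1)] (EFin \o g).
  apply: continuous_compact_integrable; first exact: segment_compact.
  exact: continuous_subspaceT.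
have tt1 : t < t + 1 by lra.
have tN1 : -1 < t by lra.
have [dF F't] := continuous_FTC1_closed tt1 gi tN1 (cg t).
have -> : f t = f t + - 0 by rewrite oppr0 addr0.
apply: (is_deriveDf _ (is_deriveNf (is_derive_constf (F 0) t))).
by apply: DeriveDef => //; rewrite -derive1E F't /g ger0_norm.
Qed.

(** * Picard iteration for bounded Lipschitz fields *)

(** With [d k] the sum of the remaining increments [c * 2^-j], [j >= k], the intervals from
    [u k - d k] to [u k + d k] are nested. The supremum of their left ends lies in all of them. *)
Lemma geometric_cauchy_limit {R : realType} (u : nat -> R) (c : R) : 0 <= c ->
  (forall k, `|u k.+1 - u k| <= c * 2^-1 ^+ k) ->
  exists l, forall k, `|l - u k| <= c * 2 * 2^-1 ^+ k.
Proof.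
move=> c0 uS; pose d k : R := c * 2 * 2^-1 ^+ k.
have dS k : d k - d k.+1 = c * 2^-1 ^+ k by rewrite /d exprS; field.
have d0 k : 0 <= d k by rewrite /d !mulr_ge0// exprn_ge0// invr_ge0.
have lowS : {homo (fun k => u k - d k) : n m / (n <= m)%N >-> n <= m}.
  apply: (homo_leq (r := fun a b => a <= b)) => //; first exact: le_trans.
  by move=> k; move: (uS k); rewrite -dS ler_norml => /andP[? ?]; lra.
have upS : {homo (fun k => - (u k + d k)) : n m / (n <= m)%N >-> n <= m}.
  apply: (homo_leq (r := fun a b => a <= b)) => //; first exact: le_trans.
  by move=> k; move: (uS k); rewrite -dS ler_norml => /andP[? ?]; lra.
have lowup j k : u j - d j <= u k + d k.
  have := lowS _ _ (leq_maxl j k); have := upS _ _ (leq_maxr j k) => /=.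
  by have := d0 (maxn j k); lra.
pose A := [set u k - d k | k in [set: nat]]%classic.
have A0 : A (u 0 - d 0) by exists 0%N.
have supA : has_sup A.
  by split; [exists (u 0 - d 0)|exists (u 0 + d 0) => _ [k _ <-]].
exists (sup A) => k; rewrite -/(d k) ler_distl; apply/andP; split.
  by apply: (ub_le_sup supA.2); exists k.
by apply: (ge_sup supA.1) => _ [j _ <-].
Qed.

Lemma half_pow_small {R : realType} (c e : R) : 0 < e ->
  exists k, c * 2^-1 ^+ k < e.
Proof.
move=> e0; exists (Num.bound (c / e)).
rewrite exprVn ltr_pdivrMr ?exprn_gt0// mulrC -ltr_pdivrMr//.
exact: upper_nthrootP (leqnn _).
Qed.

Lemma continuous_lipschitz_field {R : realType} {I : finType}
    (F : (I -> R) -> I -> R) (L : R) (X : I -> R -> R) (t : R) : 0 < L ->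
  (forall x y (c : R), (forall i, `|x i - y i| <= c) ->
    forall i, `|F x i - F y i| <= L * c) ->
  (forall i, {for t, continuous (X i)}) ->
  forall i, {for t, continuous (fun s => F (fun j => X j s) i)}.
Proof.
move=> L0 FL cX i; apply/cvgrPdist_le => e e0.
have eL : 0 < e / L by rewrite divr_gt0.
have H : \forall s \near t, forall j, `|X j t - X j s| <= e / L.
  apply: (@filter_forall _ I (fun j s => `|X j t - X j s| <= e / L) (nbhs t)) => j.
  by move: (cX j) => /cvgrPdist_le; exact.
near=> s; have -> : e = L * (e / L) by field; rewrite gt_eqF.
by apply: FL; near: s.
Unshelve. all: by end_near. Qed.

(* Picard iteration. If two consecutive iterates differ by at most
   c * expR (2 L t), the next two differ by at most half as much. *)
Lemma lipschitz_ode_global {R : realType} {I : finType}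
    (F : (I -> R) -> I -> R) (x0 : I -> R) (L K : R) : 0 < L ->
  (forall x i, `|F x i| <= K) ->
  (forall x y (c : R), (forall i, `|x i - y i| <= c) ->
    forall i, `|F x i - F y i| <= L * c) ->
  exists X : I -> R -> R, (forall i, X i 0 = x0 i) /\
    forall t : R, 0 <= t -> forall i, is_derive t 1 (X i) (F (fun j => X j t) i).
Proof.
move=> L0 FK FL.
pose P (X : I -> R -> R) := forall i (t : R), 0 <= t -> {for t, continuous (X i)}.
pose Q (X Y : I -> R -> R) := forall i, Y i 0 = x0 i /\
  forall t : R, 0 <= t -> is_derive t 1 (Y i) (F (fun j => X j t) i).
(* [step] is the Picard operator, made total: on a family that is not continuous its value is
   arbitrary. *)
have /choice[step stepP] : forall X, exists Y, P X -> Q X Y.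
  move=> X; have [PX|nPX] := pselect (P X); last by exists X.
  have /choice[G GP] : forall i, exists G : R -> R, G 0 = 0 /\
      forall t : R, 0 <= t -> is_derive t 1 G (F (fun j => X j t) i).
    move=> i; apply: antiderivative => t t0.
    by apply: (continuous_lipschitz_field _ L) => // j; exact: PX.
  exists (fun i t => G i t + x0 i) => _ i; have [G0 GD] := GP i.
  split=> [|t t0]; first by rewrite G0 add0r.
  apply: (is_derive_eq (is_deriveDf (GD t t0) (is_derive_constf (x0 i) t))).
  exact: addr0.
have QP X Y : Q X Y -> P Y.
  by move=> + i t t0 => /(_ i)[_ /(_ t t0)]; exact: is_derive_continuous.
pose xs k := iter k step (fun i _ => x0 i).
have Pxs k : P (xs k).
  elim: k => [|k IH] /=; first by move=> i t _; exact: cst_continuous.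
  exact: (QP _ _ (stepP _ IH)).
have Qxs k : Q (xs k) (xs k.+1) by exact: stepP.
(* In the norm weighted by this exponential the Picard operator contracts by 1/2 on the whole
   half-line, so no gluing of local solutions is needed. *)
pose e (t : R) := expR (2 * L * t).
have e_gt0 (t : R) : 0 < e t by exact: expR_gt0.
(* The bound [K] can be negative only when there are no coordinates at all. *)
have K0 : 0 <= K \/ (I -> False).
  have [i|I0] := pickP I; last by right => i; have := I0 i.
  by left; apply: le_trans (FK x0 i); exact: normr_ge0.
case: K0 => [K0|I0]; last first.
  by exists (fun i _ => x0 i); split => // t _ i; case: (I0 i).
pose C := K / (2 * L).
have C0 : 0 <= C by rewrite divr_ge0// mulr_ge0// ltW.
have eD (c t : R) : is_derive t 1 (fun t => c * e t) (2 * L * c * e t).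
  have Lt := is_deriveMf (is_derive_constf (2 * L) t) (is_derive_id t 1).
  apply: (is_derive_eq (is_deriveMf (is_derive_constf c t) (is_derive_expf Lt))).
  by rewrite /e; ring.
have grow i (X Y X' Y' : I -> R -> R) (c : R) : Q X X' -> Q Y Y' -> 0 <= c ->
  (forall j t, 0 <= t -> `|X j t - Y j t| <= 2 * c * e t) ->
  forall t : R, 0 <= t -> `|X' i t - Y' i t| <= c * e t.
  move=> QX QY c0 XY t t0.
  have [X'0 X'D] := QX i; have [Y'0 Y'D] := QY i.
  have := @is_derive_abs_le R (fun t => X' i t + - Y' i t)
    (fun t => F (fun j => X j t) i + - F (fun j => Y j t) i)
    (fun t => c * e t) (fun t => 2 * L * c * e t) 0 t t0.
  rewrite X'0 Y'0 addrN subr0 => H; apply: le_trans (H _ (fun s _ => eD c s) _) _.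
  - by move=> s /andP[s0 _]; exact: is_deriveDf (X'D s s0) (is_deriveNf (Y'D s s0)).
  - move=> s /andP[s0 _]; have -> : 2 * L * c * e s = L * (2 * c * e s) by ring.
    by apply: FL => j; exact: XY.
  - by rewrite gerBl mulr_ge0// ltW.
have xsS k : forall i t, 0 <= t ->
    `|xs k.+1 i t - xs k i t| <= C * 2^-1 ^+ k * e t.
  elim: k => [|k IH] i t t0.
    rewrite expr0 mulr1; have [X0 XD] := Qxs 0%N i.
    have := @is_derive_abs_le R (xs 1%N i) (fun t => F (fun j => xs 0%N j t) i)
      (fun t => C * e t) (fun t => 2 * L * C * e t) 0 t t0.
    rewrite X0 => H; apply: le_trans (H _ (fun s _ => eD C s) _) _.
    - by move=> s /andP[s0 _]; exact: XD.
    - move=> s /andP[s0 _]; apply: le_trans (FK _ _) _.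
      have -> : 2 * L * C = K by rewrite /C; field; rewrite gt_eqF.
    by rewrite ler_peMr// -expR0 ler_expR !mulr_ge0// ltW.
    - by rewrite gerBl mulr_ge0// ltW.
  apply: (grow i _ _ _ _ _ (Qxs k.+1) (Qxs k)) => //.
    by rewrite mulr_ge0// exprn_ge0.
  move=> j s s0; apply: le_trans (IH j s s0) _.
  by rewrite exprS le_eqVlt; apply/orP; left; apply/eqP; field.
(* The limit is taken at the time [|t|]: this even extension makes continuity at 0 two-sided. *)
have /choice[X XP] : forall it : I * R, exists l, forall k,
    `|l - xs k it.1 `|it.2| | <= C * e `|it.2| * 2 * 2^-1 ^+ k.
  move=> [i t]; apply: geometric_cauchy_limit; first by rewrite mulr_ge0// ltW.
  by move=> k; rewrite mulrAC; exact: xsS.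
pose Xl i (t : R) := X (i, t).
have PXl : P Xl.
  move=> i t t0; apply/cvgrPdist_le => eps eps0.
  have eps3 : 0 < eps / 3 by rewrite divr_gt0.
  have [k kP] := half_pow_small (C * e (t + 1) * 2) (eps / 3) eps3.
  have bnd (s : R) : `|s| <= t + 1 -> `|Xl i s - xs k i `|s| | <= eps / 3.
    move=> st; apply: le_trans (XP (i, s) k) _ => /=; apply: le_trans (ltW kP).
    rewrite ler_wpM2r ?exprn_ge0// ler_wpM2r// ler_wpM2l//.
    by rewrite /e ler_expR ler_wpM2l// mulr_ge0// ltW.
  have cxs : {for t, continuous (fun s => xs k i `|s|)}.
    apply: continuous_comp; first exact: norm_continuous.
    by rewrite ger0_norm//; exact: Pxs.
  have /cvgrPdist_le/(_ _ eps3) cx := cxs.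
  have /cvgrPdist_le/(_ _ ltr01) cn := @norm_continuous _ _ t.
  near=> s.
  have b1 := bnd t; rewrite ger0_norm// in b1.
  have b2 : `|s| <= t + 1.
    have : `| `|t| - `|s| | <= 1 by near: s.
    by rewrite (ger0_norm t0) ler_distlC => /andP[].
  have b3 : `|xs k i `|t| - xs k i `|s| | <= eps / 3 by near: s.
  move: (b1 ltac:(lra)) (bnd s b2) b3; rewrite (ger0_norm t0) !ler_norml.
  by move=> /andP[? ?] /andP[? ?] /andP[? ?]; apply/andP; split; lra.
have QY := stepP _ PXl; set Y := step Xl in QY.
(* The limit is a fixed point: it and its Picard image are both within a multiple of [2^-k] of the
   same iterate. *)
have XY i (t : R) : 0 <= t -> Xl i t = Y i t.
  move=> t0; apply/eqP; rewrite -subr_eq0 -normr_le0; apply/ler_addgt0Pr => eps eps0.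
  rewrite add0r; have [k kP] := half_pow_small (C * e t * 2) eps eps0.
  have H1 : `|Y i t - xs k.+1 i t| <= C * 2^-1 ^+ k * e t.
    apply: (grow i _ _ _ _ _ QY (Qxs k)) => //; first by rewrite mulr_ge0// exprn_ge0.
    move=> j s s0; have := XP (j, s) k; rewrite /= (ger0_norm s0) => /le_trans; apply.
    by rewrite le_eqVlt; apply/orP; left; apply/eqP; ring.
  have : `|Xl i t - xs k.+1 i t| <= C * e t * 2 * 2^-1 ^+ k.+1.
    by have := XP (i, t) k.+1; rewrite [(_, _).2]/= (ger0_norm t0).
  rewrite exprS => H2.
  have E1 : C * e t * 2 * (2^-1 * 2^-1 ^+ k) = C * 2^-1 ^+ k * e t by field.
  have E2 : C * e t * 2 * 2^-1 ^+ k = 2 * (C * 2^-1 ^+ k * e t) by ring.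
  move: H1 H2 kP; rewrite E1 E2; set q := C * _ * _; rewrite !ler_norml => /andP[? ?] /andP[? ?] ?.
  by apply/andP; split; lra.
exists Y; split=> [i|t t0 i]; first by have [] := QY i.
have [_ /(_ t t0)] := QY i.
by have -> : (fun j => Xl j t) = (fun j => Y j t) by apply/funext => j; exact: XY.
Unshelve. all: by end_near. Qed.

(** * Differentiation of explicit expressions by syntax-directed rules *)

Lemma is_derive_sqrf {R : realType} {f : R -> R} {x a : R} :
  is_derive x 1 f a -> is_derive x 1 (fun t => f t ^+ 2) (2 * f x * a).
Proof.
by move=> fa; apply: (is_derive_eq (is_deriveMf fa fa)); ring.
Qed.

Ltac derive_step :=
  first [ eassumption
        | eapply is_derive_constf
        | eapply is_derive_sqrf
        | eapply is_deriveDf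
        | eapply is_deriveNf
        | eapply is_deriveMf
        | eapply is_derive_expf ].

Ltac derive := eapply is_derive_eq; [repeat derive_step | cbv beta].

(** * Bounds for n = 2, 3, 4, where at most one speed differs from the others *)

(* The case lam_1 = ... = lam_(n-1) = x, lam_n = z, with N = n. *)
Definition two_speed {R : realType} (N kap cb T : R) (x z rho X Z : R -> R) :=
  forall t, 0 <= t <= T ->
  [/\ is_derive t 1 x (- x t ^+ 2 + kap * (rho t - cb)),
      is_derive t 1 z (- z t ^+ 2 + kap * (rho t - cb)),
      is_derive t 1 rho (- rho t * ((N - 1) * x t + z t)),
      is_derive t 1 X (x t) & is_derive t 1 Z (z t)].

(* The energy of y = w^(1-b) u^b where w = expR X and u = expR Z: it satisfies
   y'' = y (kap (rho - cb) - b (1 - b) (z - x)^2). *)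
Definition energy {R : realType} (N kap cb b : R) (x z rho X Z : R -> R) (t : R) :=
  expR (2 * X t + 2 * b * (Z t - X t)) *
  ((x t + b * (z t - x t)) ^+ 2 / 2 + kap / (N - 2) * rho t + kap * cb / 2
   - b * (1 - b) / 2 * (z t - x t) ^+ 2).

(** The exponent [b = 0] removes the cubic term in the gap and leaves a dissipative one; [b = 1/N]
    removes the density term. *)
Lemma energy_derive {R : realType} (N kap cb T b : R) (x z rho X Z : R -> R) t :
  N - 2 != 0 -> two_speed N kap cb T x z rho X Z -> 0 <= t <= T ->
  is_derive t 1 (energy N kap cb b x z rho X Z)
   (expR (2 * X t + 2 * b * (Z t - X t)) * (z t - x t) *
    (- ((1 - N * b) * (kap / (N - 2)) * rho t)
     + b * (1 - b) * (1 - 2 * b) * (z t - x t) ^+ 2)).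
Proof.
move=> N2 sol tT; have [dx dz dr dX dZ] := sol t tT; rewrite /energy.
derive.
by field.
Qed.

(** The forcing cancels in the difference of the two Riccati equations, leaving the linear equation
    [(z - x)' = - (x + z) (z - x)]. *)
Lemma two_speed_gap {R : realType} {N kap cb T : R} {x z rho X Z : R -> R} {t} :
  two_speed N kap cb T x z rho X Z -> X 0 = 0 -> Z 0 = 0 -> 0 <= t <= T ->
  z t - x t = (z 0 - x 0) * expR (- (X t + Z t)).
Proof.
move=> sol X0 Z0 /andP[t0 tT].
have : (z t - x t) * expR (X t + Z t) = (z 0 - x 0) * expR (X 0 + Z 0).
  apply: (@is_derive0_const _ (fun t => (z t - x t) * expR (X t + Z t))) => //.
  move=> s /andP[s0 st]; have [|dx dz dr dX dZ] := sol s.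
    by rewrite s0 (le_trans st).
  derive.
  by ring.
rewrite X0 Z0 addr0 expR0 mulr1 => <-.
by rewrite -mulrA -expRD subrr expR0 mulr1.
Qed.

Lemma two_speed_density {R : realType} {N kap cb T : R} {x z rho X Z : R -> R} {t} :
  two_speed N kap cb T x z rho X Z -> X 0 = 0 -> Z 0 = 0 -> 0 <= t <= T ->
  rho t = rho 0 * expR (- ((N - 1) * X t + Z t)).
Proof.
move=> sol X0 Z0 /andP[t0 tT].
have : rho t * expR ((N - 1) * X t + Z t) = rho 0 * expR ((N - 1) * X 0 + Z 0).
  apply: (@is_derive0_const _ (fun t => rho t * expR ((N - 1) * X t + Z t))) => //.
  move=> s /andP[s0 st]; have [|dx dz dr dX dZ] := sol s.
    by rewrite s0 (le_trans st).
  derive.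
  by ring.
rewrite X0 Z0 mulr0 addr0 expR0 mulr1 => <-.
by rewrite -mulrA -expRD subrr expR0 mulr1.
Qed.

Definition two_speed_from {R : realType} (N kap cb rho0 x0 z0 T : R)
    (x z rho X Z : R -> R) :=
  [/\ two_speed N kap cb T x z rho X Z, X 0 = 0 /\ Z 0 = 0,
      x 0 = x0, z 0 = z0 & rho 0 = rho0].

Lemma two_speed_density_gt0 {R : realType} {N kap cb rho0 x0 z0 T : R}
    {x z rho X Z : R -> R} {t} : 0 < rho0 ->
  two_speed_from N kap cb rho0 x0 z0 T x z rho X Z -> 0 <= t <= T -> 0 < rho t.
Proof.
move=> r0 [sol [X0 Z0] _ _ rE] tT.
by rewrite (two_speed_density sol X0 Z0 tT) rE mulr_gt0// expR_gt0.
Qed.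

Lemma two_speed_gap_ge0 {R : realType} {N kap cb rho0 x0 z0 T : R}
    {x z rho X Z : R -> R} {t} : x0 <= z0 ->
  two_speed_from N kap cb rho0 x0 z0 T x z rho X Z -> 0 <= t <= T -> 0 <= z t - x t.
Proof.
move=> xz [sol [X0 Z0] xE zE _] tT.
rewrite (two_speed_gap sol X0 Z0 tT) xE zE.
by rewrite mulr_ge0 ?expR_ge0// subr_ge0.
Qed.

Lemma two_speed_integral_gap_ge0 {R : realType} {N kap cb rho0 x0 z0 T : R}
    {x z rho X Z : R -> R} {t} : x0 <= z0 ->
  two_speed_from N kap cb rho0 x0 z0 T x z rho X Z -> 0 <= t <= T -> 0 <= Z t - X t.
Proof.
move=> xz S /andP[t0 tT]; have [sol [X0 Z0] _ _ _] := S.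
suff : - (Z t - X t) <= - (Z 0 - X 0) by rewrite X0 Z0; lra.
apply: (is_derive_le (fun t => - (Z t - X t)) (fun t => - (z t - x t))) => //.
  move=> s /andP[s0 st]; have [|_ _ _ dX dZ] := sol s; first by rewrite s0 (le_trans st).
  derive; by [].
move=> s /andP[s0 st]; rewrite oppr_le0.
by apply: (two_speed_gap_ge0 xz S); rewrite s0 (le_trans st).
Qed.

Definition energy0 {R : realType} (N kap cb rho0 x0 z0 b : R) :=
  (x0 + b * (z0 - x0)) ^+ 2 / 2 + kap / (N - 2) * rho0 + kap * cb / 2
   - b * (1 - b) / 2 * (z0 - x0) ^+ 2.

Lemma energy_at0 {R : realType} {N kap cb rho0 x0 z0 T b : R}
    {x z rho X Z : R -> R} :
  two_speed_from N kap cb rho0 x0 z0 T x z rho X Z ->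
  energy N kap cb b x z rho X Z 0 = energy0 N kap cb rho0 x0 z0 b.
Proof.
move=> [_ [X0 Z0] xE zE rE]; rewrite /energy /energy0 X0 Z0 xE zE rE.
by rewrite subrr !mulr0 addr0 expR0 mul1r.
Qed.

Lemma two_speed_energy_le {R : realType} {N kap cb rho0 x0 z0 T : R} (b : R)
    {x z rho X Z : R -> R} {t} : 0 < N - 2 -> x0 <= z0 ->
  two_speed_from N kap cb rho0 x0 z0 T x z rho X Z -> 0 <= t <= T ->
  (forall s, 0 <= s <= T -> b * (1 - b) * (1 - 2 * b) * (z s - x s) ^+ 2 <=
     (1 - N * b) * (kap / (N - 2)) * rho s) ->
  energy N kap cb b x z rho X Z t <= energy0 N kap cb rho0 x0 z0 b.
Proof.
move=> N2 xz S /andP[t0 tT] hb; rewrite -(energy_at0 S).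
have [sol _ _ _ _] := S.
apply: (is_derive_le _ _ _ _ t0) => [s /andP[s0 st]|s /andP[s0 st]].
  apply: energy_derive; [by rewrite gt_eqF|exact: sol|by rewrite s0 (le_trans st)].
have sT : 0 <= s <= T by rewrite s0 (le_trans st).
rewrite /= mulr_ge0_le0//.
  by rewrite mulr_ge0 ?expR_ge0// (two_speed_gap_ge0 xz S).
by rewrite addrC subr_le0 hb.
Qed.

(** For [b = 0] the energy decreases and all its terms are nonnegative, so the density term alone is
    controlled by the initial energy, uniformly in [T]. *)
Lemma two_speed_energy_b0 {R : realType} (N kap cb rho0 x0 z0 : R) :
  0 < N - 2 -> 0 < kap -> 0 < cb -> 0 < rho0 -> x0 <= z0 ->
  exists C, 0 < C /\ forall T x z rho X Z t,
    two_speed_from N kap cb rho0 x0 z0 T x z rho X Z -> 0 <= t <= T ->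
    expR (2 * X t) * rho t <= C.
Proof.
move=> N2 k0 c0 r0 xz; set e0 := energy0 N kap cb rho0 x0 z0 0.
have c1 : 0 < kap / (N - 2) by rewrite divr_gt0.
have e00 : 0 < e0.
  rewrite /e0 /energy0 !mul0r subr0 addr0; have := sqr_ge0 x0.
  by have := mulr_gt0 c1 r0; have := mulr_gt0 k0 c0; lra.
exists (e0 / (kap / (N - 2))); split; first by rewrite divr_gt0.
move=> T x z rho X Z t S tT; rewrite ler_pdivlMr//.
have rt := two_speed_density_gt0 r0 S.
have := two_speed_energy_le 0 N2 xz S tT.
rewrite -/e0 /energy => H; apply: (le_trans _ (H _)); last first.
  by move=> s sT; rewrite !mul0r mulr0 subr0 mul1r mulr_ge0// ltW// rt.
rewrite mulr0 !mul0r !addr0 subr0 -[leLHS]mulrA ler_wpM2l ?expR_ge0//.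
by have := sqr_ge0 (x t); have := mulr_gt0 k0 c0; rewrite [rho t * _]mulrC; lra.
Qed.

(* For N = 3 the energy with a small exponent b improves the bound with b = 0. *)
Lemma two_speed_gap_decay {R : realType} (N kap cb rho0 x0 z0 : R) :
  N = 3 \/ N = 4 -> 0 < kap -> 0 < cb -> 0 < rho0 -> x0 <= z0 ->
  exists eps C, [/\ 0 < eps, 0 < C & forall T x z rho X Z t,
    two_speed_from N kap cb rho0 x0 z0 T x z rho X Z -> 0 <= t <= T ->
    (z t - x t) ^+ 2 <= C * expR (- (eps * (Z t - X t))) * rho t].
Proof.
move=> N34 k0 c0 r0 xz; pose a := z0 - x0.
have a2 : 0 <= a ^+ 2 by exact: sqr_ge0.
case: N34 => ->; last first.
  (* For [N = 4] the explicit formulas suffice: the squared gap over the density is [a^2 / rho0]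
     times [expR (X - Z)]. The added 1 keeps the constant positive when [a = 0]. *)
  exists 1, (a ^+ 2 / rho0 + 1); split; first exact: ltr01.
    by rewrite ltr_wpDl// divr_ge0// ltW.
  move=> T x z rho X Z t [sol [X0 Z0] xE zE rE] tT.
  rewrite (two_speed_density sol X0 Z0 tT).
  rewrite (two_speed_gap sol X0 Z0 tT) xE zE rE -/a.
  have -> : (a * expR (- (X t + Z t))) ^+ 2 =
      a ^+ 2 * (expR (- (1 * (Z t - X t))) * expR (- ((4 - 1) * X t + Z t))).
    by rewrite exprMn [expR _ ^+ 2]expr2 -!expRD; congr (_ * expR _); ring.
  have := expR_ge0 (- (1 * (Z t - X t))); have := expR_ge0 (- ((4 - 1) * X t + Z t)).
  set A := expR _; set B := expR _ => A0 B0.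
  have -> : (a ^+ 2 / rho0 + 1) * B * (rho0 * A) = (a ^+ 2 + rho0) * (B * A).
    by field; rewrite gt_eqF.
  by rewrite ler_wpM2r ?mulr_ge0// lerDl ltW.
have N2 : 0 < 3 - 2 :> R by lra.
have [C1 [C1_gt0 b0]] := two_speed_energy_b0 _ _ _ _ _ _ N2 k0 c0 r0 xz.
(* For [N = 3] the same quotient is [expR (- Z)] up to a constant, which carries no decay in [Z - X]
   by itself. The bound for [b = 0] only says that [expR (- Z)] is bounded. *)
have gapE T x z rho X Z t : two_speed_from 3 kap cb rho0 x0 z0 T x z rho X Z ->
    0 <= t <= T -> (z t - x t) ^+ 2 = a ^+ 2 / rho0 * expR (- Z t) * rho t.
  move=> [sol [X0 Z0] xE zE rE] tT.
  rewrite (two_speed_density sol X0 Z0 tT).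
  rewrite (two_speed_gap sol X0 Z0 tT) xE zE rE -/a.
  have -> : a ^+ 2 / rho0 * expR (- Z t) * (rho0 * expR (- ((3 - 1) * X t + Z t))) =
    a ^+ 2 * (expR (- Z t) * expR (- ((3 - 1) * X t + Z t))) by field; rewrite gt_eqF.
  by rewrite exprMn [expR _ ^+ 2]expr2 -!expRD; congr (_ * expR _); ring.
have rhoE T x z rho X Z t (w : R) : two_speed_from 3 kap cb rho0 x0 z0 T x z rho X Z ->
    0 <= t <= T -> expR (2 * X t + w) * rho t = rho0 * (expR w * expR (- Z t)).
  move=> [sol [X0 Z0] xE zE rE] tT.
  rewrite (two_speed_density sol X0 Z0 tT) rE.
  by rewrite mulrCA -!expRD; congr (_ * expR _); ring.
pose C2 := a ^+ 2 / rho0 * (C1 / rho0).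
have C20 : 0 <= C2 by apply: mulr_ge0; apply: divr_ge0 => //; exact: ltW.
(* This choice gives [b <= 1/6] and [b * C2 <= kap / 2]. Hence [b] times the squared gap is at most
   [kap / 2 * rho], which is at most [(1 - 3 b) kap rho], and the energy with exponent [b]
   decreases. *)
pose b := kap / (6 * kap + 2 * C2).
have den0 : 0 < 6 * kap + 2 * C2 by lra.
have bE : b * (6 * kap + 2 * C2) = kap by rewrite /b divfK ?gt_eqF.
have bgt0 : 0 < b by rewrite divr_gt0.
have b6 : b <= 1 / 6.
  by rewrite /b ler_pdivrMr//; lra.
have bC2 : b * C2 <= kap / 2.
  by rewrite -bE; have := mulr_gt0 bgt0 k0; lra.
have gapC2 T x z rho X Z t : two_speed_from 3 kap cb rho0 x0 z0 T x z rho X Z ->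
    0 <= t <= T -> (z t - x t) ^+ 2 <= C2 * rho t.
  move=> S tT; have rt := two_speed_density_gt0 r0 S tT.
  rewrite (gapE _ _ _ _ _ _ _ S tT) /C2 ler_pM2r// ler_wpM2l//.
    by rewrite divr_ge0// ltW.
  have := b0 _ _ _ _ _ _ _ S tT; rewrite -[2 * X t]addr0 (rhoE _ _ _ _ _ _ _ _ S tT).
  by rewrite expR0 mul1r ler_pdivlMr// mulrC.
pose e0 := energy0 3 kap cb rho0 x0 z0 b.
have hb T x z rho X Z t : two_speed_from 3 kap cb rho0 x0 z0 T x z rho X Z ->
    0 <= t <= T -> expR (2 * X t + 2 * b * (Z t - X t)) * rho t * (kap / 2) <= e0.
  move=> S tT; have rt := two_speed_density_gt0 r0 S.
  have bgap s : 0 <= s <= T -> b * (z s - x s) ^+ 2 <= kap / 2 * rho s.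
    move=> sT; apply: (@le_trans _ _ (b * (C2 * rho s))).
      by rewrite ler_pM2l// (gapC2 _ _ _ _ _ _ _ S sT).
    by rewrite mulrA ler_wpM2r// ltW// rt.
  have := two_speed_energy_le b N2 xz S tT.
  rewrite -/e0 /energy => H; apply: (le_trans _ (H _)); last first.
    move=> s sT; have := bgap s sT; have := rt s sT; have := sqr_ge0 (z s - x s).
    set d2 := (z s - x s) ^+ 2 => d20 rs bd.
    have -> : 3 - 2 = 1 :> R by ring.
    have : b * (1 - b) * (1 - 2 * b) * d2 <= b * d2.
      have -> : b * (1 - b) * (1 - 2 * b) * d2 = (b * d2) * ((1 - b) * (1 - 2 * b)) by ring.
      by apply: ler_piMr; [exact: mulr_ge0 (ltW bgt0) d20|apply: mulr_ile1; lra].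
    have : kap / 2 * rho s <= (1 - 3 * b) * (kap / 1) * rho s.
      by rewrite ler_pM2r// divr1 mulrC ler_pM2r//; lra.
    lra.
  rewrite -[leLHS]mulrA ler_wpM2l ?expR_ge0//.
  have := bgap t tT; have := rt t tT; have := sqr_ge0 (z t - x t).
  set d2 := (z t - x t) ^+ 2 => d20 rs bd.
  have : b * (1 - b) / 2 * d2 <= (b * d2) / 2.
    have -> : b * (1 - b) / 2 * d2 = (b * d2) / 2 * (1 - b) by ring.
    by apply: ler_piMr; [apply: divr_ge0 => //; exact: mulr_ge0 (ltW bgt0) d20|lra].
  have -> : kap / (3 - 2) * rho t = kap * rho t by field.
  have := mulr_gt0 k0 rs; have := mulr_gt0 k0 c0.
  have := sqr_ge0 (x t + b * (z t - x t)).
  have -> : rho t * (kap / 2) = kap * rho t / 2 by ring.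
  move: bd; have -> : kap / 2 * rho t = kap * rho t / 2 by ring.
  by lra.
(* By [rhoE], the bound [hb] reads [expR (- Z) <= const * expR (- 2 b (Z - X))]. Inserted in [gapE],
   it yields the decay with rate [2 * b]. *)
pose C := a ^+ 2 / rho0 * (`|e0| / (kap / 2) / rho0) + 1.
exists (2 * b), C; split; [lra| |move=> T x z rho X Z t S tT].
  apply: ltr_wpDl => //; apply: mulr_ge0; first exact: divr_ge0 a2 (ltW r0).
  by apply: divr_ge0; [apply: divr_ge0 => //; lra|exact: ltW].
have rt := two_speed_density_gt0 r0 S tT.
rewrite (gapE _ _ _ _ _ _ _ S tT) ler_pM2r//.
rewrite /C mulrDl; apply: ler_wpDr; first by rewrite mul1r expR_ge0.
rewrite -[leRHS]mulrA; apply: ler_wpM2l; first exact: divr_ge0 a2 (ltW r0).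
have k2 : 0 < kap / 2 by lra.
rewrite [expR (- (2 * b * _))]expRN ler_pdivlMr ?expR_gt0// !ler_pdivlMr//.
have := le_trans (hb _ _ _ _ _ _ _ S tT) (ler_norm _).
by rewrite (rhoE _ _ _ _ _ _ _ _ S tT); congr (_ <= _); ring.
Qed.

Definition two_speed_bound {R : realType} (N kap cb rho0 x0 z0 : R) :=
  exists M, forall T x z rho X Z t,
    two_speed_from N kap cb rho0 x0 z0 T x z rho X Z -> 0 <= t <= T ->
    [/\ `|x t| <= M, `|z t| <= M & `|rho t| <= M].

Lemma normr_le_1sqr {R : realType} (x : R) : `|x| <= 1 + x ^+ 2.
Proof.
by rewrite ler_norml; have := sqr_ge0 (x - 1); have := sqr_ge0 (x + 1);
  have := sqr_ge0 x; rewrite !expr2 => *; apply/andP; split; lra.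
Qed.

Lemma expR_upper_barrier {R : realType} (eps D A : R) : 0 < eps -> 0 < A ->
  A^-1 < expR (- (eps * D)) -> D <= A / eps.
Proof.
move=> eps0 A0; rewrite expRN ltf_pV2 ?posrE ?expR_gt0// => DA.
rewrite ler_pdivlMr// mulrC; apply: le_trans (ltW DA).
by have := expR_ge1Dx (eps * D); lra.
Qed.

(** Gronwall's inequality for the energy with [b = 1/N]. By the gap decay its growth rate is at most
    [K * d * expR (- eps * D)] with [d = D'], and this rate has integral at most [K / eps] whatever
    the length of the time interval. *)
Lemma two_speed_bounded {R : realType} (N kap cb rho0 x0 z0 : R) :
  N = 3 \/ N = 4 -> 0 < kap -> 0 < cb -> 0 < rho0 -> x0 <= z0 ->
  two_speed_bound N kap cb rho0 x0 z0.
Proof.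
move=> N34 k0 c0 r0 xz.
have N2 : 0 < N - 2 by case: N34 => ->; lra.
have [C1 [C1_gt0 b0]] := two_speed_energy_b0 _ _ _ _ _ _ N2 k0 c0 r0 xz.
have [eps [C [eps0 C0 decay]]] := two_speed_gap_decay _ _ _ _ _ _ N34 k0 c0 r0 xz.
(* [g] and [h] are the coefficients of the squared gap in the energy and of the cubed gap in its
   derivative. *)
pose b := N^-1; pose g := b * (1 - b) / 2; pose h := b * (1 - b) * (1 - 2 * b).
have bN : N * b = 1 by rewrite /b; case: N34 => ->; field.
have bgt0 : 0 < b by rewrite invr_gt0; lra.
have b3 : b <= 1 / 3 by case: N34 => NE; move: bN; rewrite NE; lra.
have g0 : 0 < g by rewrite /g !divr_gt0// mulr_gt0//; lra.
have h0 : 0 < h by rewrite /h !mulr_gt0//; lra.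
pose c1 := kap / (N - 2).
have c10 : 0 < c1 by rewrite divr_gt0.
pose A := 2 * g * C / c1.
have A0 : 0 < A by apply: divr_gt0 => //; apply: mulr_gt0 => //; apply: mulr_gt0.
pose C3 := g * C * C1 * expR (2 * b * (A / eps)).
have gCC1 : 0 < g * C * C1 by apply: mulr_gt0 => //; apply: mulr_gt0.
have C30 : 0 <= C3 by apply: mulr_ge0; [exact: ltW|exact: expR_ge0].
pose K := 2 * h * C / c1.
have K0 : 0 < K by apply: divr_gt0 => //; apply: mulr_gt0 => //; apply: mulr_gt0.
pose e0 := energy0 N kap cb rho0 x0 z0 b + C3 + 1.
pose B := e0 * expR (K / eps).
pose Y := 2 * B / c1 / rho0.
pose M1 := 2 * B / c1 * (1 + Y ^+ 2).
pose M2 := 2 * B * (1 + Y ^+ 2).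
exists (10 + M2 + 4 * (C * M1) + M1) => T x z rho X Z t S tT.
pose y2 s := expR (2 * X s + 2 * b * (Z s - X s)).
pose d s := z s - x s; pose D s := Z s - X s; pose mu s := x s + b * d s.
pose H s := energy N kap cb b x z rho X Z s + (C3 + 1).
have y20 s : 0 < y2 s by exact: expR_gt0.
have rt s : 0 <= s <= T -> 0 < rho s by exact: two_speed_density_gt0 r0 S.
have d0 s : 0 <= s <= T -> 0 <= d s by exact: two_speed_gap_ge0 xz S.
have D0 s : 0 <= s <= T -> 0 <= D s by exact: two_speed_integral_gap_ge0 xz S.
(* If [expR (- eps * D) <= 1/A], half of the density term absorbs the gap term. Otherwise
   [D <= A / eps], and the bound for [b = 0] makes the gap term at most [C3]. *)
have gap_ctrl s : 0 <= s <= T -> y2 s * (g * d s ^+ 2) <= y2 s * (c1 / 2 * rho s) + C3.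
  move=> sT; have rs := rt s sT.
  have dE := decay _ _ _ _ _ _ _ S sT; rewrite -/(d s) -/(D s) in dE.
  have gdE : g * d s ^+ 2 <= g * (C * expR (- (eps * D s)) * rho s) by rewrite ler_pM2l.
  have [small|big] := leP (expR (- (eps * D s))) A^-1.
    apply: ler_wpDr => //; rewrite ler_pM2l//; apply: (le_trans gdE).
    have -> : c1 / 2 * rho s = g * (C * A^-1 * rho s).
      by rewrite /A; field; rewrite !gt_eqF.
    by rewrite ler_pM2l// ler_pM2r// ler_pM2l.
  apply: ler_wpDl; first by have := mulr_gt0 (y20 s) (mulr_gt0 c10 rs); lra.
  have DA := expR_upper_barrier _ _ _ eps0 A0 big.
  have e1 : expR (- (eps * D s)) <= 1.
    by rewrite -[leRHS]expR0 ler_expR oppr_le0; exact: mulr_ge0 (ltW eps0) (D0 s sT).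
  apply: (@le_trans _ _ (y2 s * (g * (C * 1 * rho s)))).
    rewrite ler_pM2l//; apply: (le_trans gdE).
    by rewrite ler_pM2l// ler_pM2r// ler_pM2l.
  have -> : y2 s * (g * (C * 1 * rho s)) =
      g * C * (expR (2 * X s) * rho s) * expR (2 * b * D s).
    by rewrite /y2 expRD -/(D s); ring.
  rewrite /C3; apply: ler_pM; rewrite ?expR_ge0//.
  - by apply: mulr_ge0; [apply/ltW/mulr_gt0|apply: mulr_ge0; [exact: expR_ge0|exact: ltW]].
  - by apply: ler_wpM2l; [apply/ltW/mulr_gt0|exact: b0 S sT].
  - by rewrite ler_expR ler_pM2l// mulr_gt0.
have Hlow s : 0 <= s <= T ->
    1 + y2 s * (mu s ^+ 2 / 2) + y2 s * (c1 / 2 * rho s) <= H s.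
  move=> sT; have := gap_ctrl s sT.
  have := mulr_gt0 (y20 s) (mulr_gt0 k0 c0).
  by rewrite /H /energy -/(y2 s) -/(d s) -/(mu s) -/g -/c1; lra.
have H0 s : 0 <= s <= T -> 0 < H s.
  move=> sT; apply: lt_le_trans (Hlow s sT).
  have := mulr_ge0 (ltW (y20 s)) (sqr_ge0 (mu s)).
  by have := mulr_gt0 (y20 s) (mulr_gt0 c10 (rt s sT)); lra.
(* The exponent is an antiderivative of minus the growth rate, so [G] is nonincreasing; it lies
   above [H], as the weight is at least 1. *)
pose G s := H s * expR (K / eps * expR (- (eps * (Z s - X s)))).
have GD s : 0 <= s <= T -> is_derive s 1 G
    ((y2 s * d s * (h * d s ^+ 2) - K * d s * expR (- (eps * D s)) * H s) *
     expR (K / eps * expR (- (eps * D s)))).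
  move=> sT; have [sol _ _ _ _] := S; have [_ _ _ dX dZ] := sol s sT.
  have N2' : N - 2 != 0 by rewrite gt_eqF.
  have dE := energy_derive _ _ _ _ b _ _ _ _ _ _ N2' sol sT.
  rewrite /G /H; derive.
  rewrite -/(y2 s) -/(d s) -/(D s) bN subrr !mul0r oppr0 add0r -/h /H.
  by field; rewrite gt_eqF.
have HB s : 0 <= s <= T -> H s <= B.
  move=> /andP[s0 sT].
  have GG : G s <= G 0.
    apply: (is_derive_le _ _ _ _ s0) => [r /andP[r0' rs]|r /andP[r0' rs]].
      by apply: GD; rewrite r0' (le_trans rs).
    have rT : 0 <= r <= T by rewrite r0' (le_trans rs).
    apply: mulr_le0_ge0; last exact: expR_ge0.
    have -> : y2 r * d r * (h * d r ^+ 2) - K * d r * expR (- (eps * D r)) * H r =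
       d r * (y2 r * (h * d r ^+ 2) - K * expR (- (eps * D r)) * H r) by ring.
    apply: mulr_ge0_le0; first exact: d0.
    rewrite subr_le0; apply: (@le_trans _ _ (y2 r * (h * (C * expR (- (eps * D r)) * rho r)))).
      by rewrite ler_pM2l// ler_pM2l//; exact: decay S rT.
    have -> : y2 r * (h * (C * expR (- (eps * D r)) * rho r)) =
      K * expR (- (eps * D r)) * (y2 r * (c1 / 2 * rho r)).
      by rewrite /K; field; rewrite gt_eqF.
    apply: ler_wpM2l; first by apply/ltW/mulr_gt0 => //; exact: expR_gt0.
    apply: le_trans (Hlow r rT).
    by have := mulr_ge0 (ltW (y20 r)) (sqr_ge0 (mu r)); lra.
  have G0E : G 0 = B.
    have [_ [X0 Z0] _ _ _] := S.
    rewrite /G /H (energy_at0 S) X0 Z0 subrr mulr0 oppr0 expR0 mulr1.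
    by rewrite /B /e0 addrA.
  rewrite -G0E; apply: le_trans GG; rewrite /G.
  rewrite ler_peMr ?(ltW (H0 s _)) ?s0//.
  by rewrite -expR0 ler_expR; apply: mulr_ge0; [apply: divr_ge0; exact: ltW|exact: expR_ge0].
have Ht := le_trans (Hlow t tT) (HB t tT).
have rho_t := rt t tT.
have p1 := mulr_ge0 (ltW (y20 t)) (sqr_ge0 (mu t)).
have p2 := mulr_gt0 (y20 t) (mulr_gt0 c10 rho_t).
have yr : y2 t * rho t <= 2 * B / c1 by rewrite ler_pdivlMr//; lra.
have ym : y2 t * mu t ^+ 2 <= 2 * B by lra.
have BpE : 0 < 2 * B / c1 by apply: lt_le_trans yr; rewrite mulr_gt0.
(* With [y2 = y^2], the quantity [y2 * rho / rho0] equals [y^(2-N)]: it is [1/y] for [N = 3], to be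
   squared, and already [1/y^2] for [N = 4]. *)
have yinv : (y2 t)^-1 <= 1 + Y ^+ 2.
  have [sol [X0 Z0] xE zE rE] := S.
  have yrE : y2 t * rho t / rho0 = expR (2 * X t + 2 * b * (Z t - X t) - ((N - 1) * X t + Z t)).
    rewrite (two_speed_density sol X0 Z0 tT) rE expRD /y2.
    by field; rewrite gt_eqF.
  have yY : y2 t * rho t / rho0 <= Y by rewrite ler_pM2r ?invr_gt0.
  have Y0 : 0 <= Y by rewrite divr_ge0 ?ltW.
  rewrite /y2 -expRN; move: yY; rewrite yrE; case: N34 => NE.
    have bE : b = 1 / 3 by move: bN; rewrite NE; lra.
    rewrite NE bE => yY; apply: ler_wpDl => //.
    have -> : expR (- (2 * X t + 2 * (1 / 3) * (Z t - X t))) =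
      expR (2 * X t + 2 * (1 / 3) * (Z t - X t) - ((3 - 1) * X t + Z t)) ^+ 2.
      by rewrite expr2 -expRD; congr expR; field.
    by rewrite ler_pXn2r// nnegrE ?expR_ge0.
  have bE : b = 1 / 4 by move: bN; rewrite NE; lra.
  rewrite NE bE => yY; apply: (@le_trans _ _ Y); last first.
    by rewrite (le_trans (ler_norm Y))// normr_le_1sqr.
  by apply: le_trans yY; rewrite ler_expR; lra.
have Y1 : 0 < 1 + Y ^+ 2 by have := sqr_ge0 Y; lra.
have bound_y (v c : R) : 0 <= c -> y2 t * v <= c -> v <= c * (1 + Y ^+ 2).
  move=> c_ge0 yv; apply: (@le_trans _ _ (c / y2 t)); last exact: ler_wpM2l.
  by rewrite ler_pdivlMr// mulrC.
have rM : rho t <= M1 by apply: bound_y yr; exact: ltW.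
have B0 : 0 <= 2 * B by apply: le_trans ym.
have muM : mu t ^+ 2 <= M2 by apply: bound_y ym.
have dM : d t ^+ 2 <= C * M1.
  apply: (@le_trans _ _ (C * 1 * rho t)); last by rewrite mulr1 ler_pM2l.
  apply: le_trans (decay _ _ _ _ _ _ _ S tT) _; rewrite ler_pM2r// ler_pM2l//.
  by rewrite -[leRHS]expR0 ler_expR oppr_le0; exact: mulr_ge0 (ltW eps0) (D0 t tT).
have dt := d0 t tT.
have := normr_le_1sqr (mu t); have := normr_le_1sqr (d t).
rewrite (ger0_norm dt) => dn; rewrite ler_norml => /andP[m1 m2].
have xE : x t = mu t - b * d t by rewrite /mu; ring.
have zE : z t = x t + d t by rewrite /d; ring.
have bd : 0 <= b * d t <= d t.
  by rewrite (mulr_ge0 (ltW bgt0) dt); apply: ler_piMl => //; lra.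
move/andP: bd => [bd1 bd2].
have := sqr_ge0 (d t); have := sqr_ge0 (mu t) => q1 q2.
clear -xE zE bd1 bd2 q1 q2 m1 m2 dn dM muM rM rho_t dt.
by split; rewrite ?ler_norml ?zE ?xE; apply/andP; split; lra.
Qed.

(** Both speeds coincide here, and the potential [kap / (N - 2) * rho] degenerates to a logarithm:
    the conserved energy contains [- kap * rho0 * X] instead. *)
Lemma two_speed_bounded2 {R : realType} (kap cb rho0 x0 : R) :
  0 < kap -> 0 < cb -> 0 < rho0 -> two_speed_bound 2 kap cb rho0 x0 x0.
Proof.
move=> k0 c0 r0; have kr := mulr_gt0 k0 r0.
pose e0 := x0 ^+ 2 / 2 + kap * cb / 2.
pose m := e0 / (kap * rho0).
pose P := expR (2 * m).
exists (1 + 2 * (e0 * P) + 2 * (kap * rho0) + rho0 * P) => T x z rho X Z t S tT.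
have [sol [X0 Z0] xE zE rE] := S.
have zx s : 0 <= s <= T -> z s = x s.
  move=> sT; apply/eqP; rewrite -subr_eq0 (two_speed_gap sol X0 Z0 sT) xE zE.
  by rewrite subrr mul0r.
have ZX s : 0 <= s <= T -> Z s = X s.
  move=> /andP[s0 sT].
  have : Z s - X s = Z 0 - X 0.
    apply: (@is_derive0_const _ (fun s => Z s - X s)) => // r /andP[r0' rs].
    have rT : 0 <= r <= T by rewrite r0' (le_trans rs).
    have [_ _ _ dX dZ] := sol r rT; derive; by rewrite zx// subrr.
  by rewrite X0 Z0; lra.
have rhoX s : 0 <= s <= T -> rho s = rho0 * expR (- (2 * X s)).
  move=> sT; rewrite (two_speed_density sol X0 Z0 sT) rE ZX//.
  by congr (_ * expR _); ring.
have cons s : 0 <= s <= T ->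
    expR (2 * X s) * (x s ^+ 2 / 2 + kap * cb / 2) - kap * rho0 * X s = e0.
  move=> /andP[s0 sT].
  have -> : e0 = expR (2 * X 0) * (x 0 ^+ 2 / 2 + kap * cb / 2) - kap * rho0 * X 0.
    by rewrite X0 xE !mulr0 expR0 mul1r subr0.
  apply: (@is_derive0_const _ (fun s => expR (2 * X s) * (x s ^+ 2 / 2 + kap * cb / 2)
    - kap * rho0 * X s)) => // r /andP[r0' rs].
  have rT : 0 <= r <= T by rewrite r0' (le_trans rs).
  have [dx _ _ dX _] := sol r rT; derive.
  have -> : rho0 = expR (2 * X r) * rho r.
    by rewrite rhoX// mulrCA -expRD subrr expR0 mulr1.
  by field.
have ct := cons t tT.
have kc := mulr_gt0 k0 c0.
have y0 := expR_gt0 (2 * X t).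
have e00 : 0 <= e0 by rewrite /e0; have := sqr_ge0 x0; lra.
have Xm : - X t <= m.
  rewrite /m ler_pdivlMr// -ct.
  have := mulr_ge0 (ltW y0) (sqr_ge0 (x t)); have := mulr_gt0 y0 kc; lra.
have yP : expR (- (2 * X t)) <= P by rewrite ler_expR; lra.
(* The potential grows only linearly in [X] while the kinetic term carries the factor
   [expR (2 * X)]; this controls the speed even if [X] is large. *)
have XeX : X t * expR (- (2 * X t)) <= 1.
  rewrite expRN ler_pdivrMr// mul1r.
  have := expR_ge1Dx (2 * X t); have [X0'|X0'] := leP 0 (X t); lra.
have P0 : 0 < P by exact: expR_gt0.
have x2 : x t ^+ 2 <= 2 * (e0 * P) + 2 * (kap * rho0).
  have : x t ^+ 2 / 2 + kap * cb / 2 = (e0 + kap * rho0 * X t) * expR (- (2 * X t)).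
    rewrite -ct; set y := expR (2 * _); rewrite expRN -/y.
    by field; rewrite gt_eqF.
  have : e0 * expR (- (2 * X t)) <= e0 * P by rewrite ler_wpM2l.
  have : kap * rho0 * (X t * expR (- (2 * X t))) <= kap * rho0 * 1 by rewrite ler_pM2l.
  lra.
have rP : rho t <= rho0 * P by rewrite rhoX// ler_pM2l.
have rt : 0 < rho t by rewrite rhoX// mulr_gt0// expR_gt0.
have xn := normr_le_1sqr (x t).
have p1 := mulr_ge0 e00 (ltW P0); have p2 := mulr_gt0 r0 P0.
by split; rewrite ?zx ?(gtr0_norm rt)//; lra.
Qed.

(** * Bounds for n >= 5 through the moments of the speeds *)

(* [m1], [m2], [m3] stand for the power sums of the lam_i. *)
Definition moment_system {R : realType} (N kap cb T : R) (m1 m2 m3 rho S : R -> R) :=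
  forall t, 0 <= t <= T ->
  [/\ is_derive t 1 m1 (- m2 t + N * (kap * (rho t - cb))),
      is_derive t 1 m2 (- 2 * m3 t + 2 * (kap * (rho t - cb)) * m1 t),
      is_derive t 1 rho (- rho t * m1 t) & is_derive t 1 S (m1 t)].

Definition second_central_moment {R : realType} (N m1 m2 : R) := m2 / N - (m1 / N) ^+ 2.

Definition third_central_moment {R : realType} (N m1 m2 m3 : R) :=
  m3 / N - 3 * (m1 / N) * (m2 / N) + 2 * (m1 / N) ^+ 3.

(* The energy of y = expR (S / N), the geometric mean of the functions
   expR (integral of lam_i): it satisfies
   y'' = y (kap (rho - cb) - variance), and rho = rho0 y^(-N). *)
Lemma moment_energy_derive {R : realType} {N kap cb T : R} {m1 m2 m3 rho S : R -> R} {t} :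
  N != 0 -> N - 2 != 0 -> moment_system N kap cb T m1 m2 m3 rho S -> 0 <= t <= T ->
  is_derive t 1 (fun s => expR (2 / N * S s) *
    ((m1 s / N) ^+ 2 / 2 + kap / (N - 2) * rho s + kap * cb / 2
      - (m2 s / N - (m1 s / N) ^+ 2) / 2))
    (expR (2 / N * S t) * third_central_moment N (m1 t) (m2 t) (m3 t)).
Proof.
move=> N0 N2 sol tT; have [d1 d2 dr dS] := sol t tT; rewrite /third_central_moment.
derive.
by field; rewrite N0.
Qed.

(** The common forcing shifts all speeds equally and drops out of the variance, whose derivative is
    [- 2 M3 - 4 (m1 / N) Var]; the factor [y^4] cancels the second term. *)
Lemma moment_variance_derive {R : realType} {N kap cb T : R} {m1 m2 m3 rho S : R -> R} {t} :
  N != 0 -> moment_system N kap cb T m1 m2 m3 rho S -> 0 <= t <= T ->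
  is_derive t 1 (fun s => expR (4 / N * S s) * (m2 s / N - (m1 s / N) ^+ 2))
    (- 2 * expR (4 / N * S t) * third_central_moment N (m1 t) (m2 t) (m3 t)).
Proof.
move=> N0 sol tT; have [d1 d2 dr dS] := sol t tT; rewrite /third_central_moment.
derive.
by field.
Qed.

Lemma moment_density {R : realType} {N kap cb T : R} {m1 m2 m3 rho S : R -> R} {t} :
  moment_system N kap cb T m1 m2 m3 rho S -> S 0 = 0 -> 0 <= t <= T ->
  rho t = rho 0 * expR (- S t).
Proof.
move=> sol S0 /andP[t0 tT].
have : rho t * expR (S t) = rho 0 * expR (S 0).
  apply: (@is_derive0_const _ (fun t => rho t * expR (S t))) => //.
  move=> s /andP[s0 st]; have [|d1 d2 dr dS] := sol s.
    by rewrite s0 (le_trans st).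
  derive.
  by ring.
rewrite S0 expR0 mulr1 => <-.
by rewrite -mulrA -expRD subrr expR0 mulr1.
Qed.

(* With w = expR (- S / N), this is Young's inequality
   w^2 <= eta w^(N-2) + eta^(-2). *)
Lemma expR_interpolation {R : realType} (N S eta : R) : 5 <= N -> 0 < eta -> eta <= 1 ->
  expR (- (2 / N * S)) <= eta * expR (2 / N * S - S) + eta ^- 2.
Proof.
move=> N5 eta0 eta1; pose w := expR (- (S / N)).
have N0 : N != 0 by rewrite gt_eqF//; lra.
have w0 : 0 < w by exact: expR_gt0.
have -> : expR (- (2 / N * S)) = w ^+ 2.
  by rewrite expr2 -expRD; congr expR; field.
have ei : 1 <= eta^-1 by rewrite invf_ge1.
have [small|big] := leP w eta^-1.
  apply: ler_wpDl; first by rewrite mulr_ge0 ?expR_ge0// ltW.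
  by rewrite -exprVn ler_pXn2r// nnegrE ?invr_ge0// ltW.
apply: ler_wpDr; first by rewrite invr_ge0 exprn_ge0// ltW.
have -> : expR (2 / N * S - S) = w ^+ 2 * expR (- (S / N) * (N - 4)).
  by rewrite expr2 -!expRD; congr expR; field.
rewrite mulrCA; apply: ler_peMr; first exact: exprn_ge0 (ltW w0).
rewrite -[leLHS](@mulfV _ eta) ?gt_eqF// ler_pM2l//.
apply: (le_trans (ltW big)); rewrite ler_expR.
have SN : 0 <= - (S / N) by rewrite -ler_expR expR0 -/w; lra.
by rewrite ler_peMr//; lra.
Qed.

(** The energy gains [y^2 M3] while [psi = y^4 Var] loses [2 y^4 M3]. Since [1/y^2 <= K * H], the
    loss of [psi], weighted by [K * H / 2], pays for the gain, and [psi] stays between 0 and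
    [V0]. *)
Lemma moment_bounded {R : realType} (N kap cb rho0 a1 a2 : R) :
  5 <= N -> 0 < kap -> 0 < cb -> 0 < rho0 ->
  exists M, forall T m1 m2 m3 rho S t,
    moment_system N kap cb T m1 m2 m3 rho S -> S 0 = 0 ->
    m1 0 = a1 -> m2 0 = a2 -> rho 0 = rho0 ->
    (forall s, 0 <= s <= T -> 0 <= second_central_moment N (m1 s) (m2 s)) ->
    (forall s, 0 <= s <= T -> 0 <= third_central_moment N (m1 s) (m2 s) (m3 s)) ->
    0 <= t <= T -> `|rho t| <= M /\ m2 t <= M.
Proof.
move=> N5 k0 c0 r0.
have N2 : 0 < N - 2 by lra.
have Ngt0 : 0 < N by lra.
have N0 : N != 0 by rewrite gt_eqF.
pose V0 := `|second_central_moment N a1 a2|; pose c1 := kap / (N - 2).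
have V00 : 0 <= V0 by exact: normr_ge0.
have c10 : 0 < c1 by rewrite divr_gt0.
have cr : 0 < c1 * rho0 by rewrite mulr_gt0.
(* The interpolation parameter satisfies [eta <= 1] and [V0 * eta <= c1 * rho0], so that half of the
   density term absorbs the variance term up to the constant [C3]. *)
pose eta := c1 * rho0 / (c1 * rho0 + V0).
have den : 0 < c1 * rho0 + V0 by lra.
have eta0 : 0 < eta by rewrite divr_gt0.
have etaE : eta * (c1 * rho0 + V0) = c1 * rho0 by rewrite divfK ?gt_eqF.
have eta1 : eta <= 1 by rewrite ler_pdivrMr//; lra.
have Veta : V0 * eta <= c1 * rho0.
  by rewrite -etaE mulrC ler_pM2l//; lra.
pose C3 := V0 * eta ^- 2 / 2.
have e2 : 0 < eta ^- 2 by rewrite invr_gt0 exprn_gt0.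
have C30 : 0 <= C3 by apply: divr_ge0 => //; apply: mulr_ge0 => //; exact: ltW.
pose K := 2 * eta / (rho0 * c1) + eta ^- 2.
have K1 : 0 < 2 * eta / (rho0 * c1).
  by apply: divr_gt0; [apply: mulr_gt0|apply: mulr_gt0].
have K0 : 0 < K by rewrite addr_gt0.
pose e0 := (a1 / N) ^+ 2 / 2 + c1 * rho0 + kap * cb / 2 - second_central_moment N a1 a2 / 2 + (C3 + 1).
pose B := e0 * expR (K / 2 * V0).
pose Mr := 2 * B / c1 * (K * B).
pose Mm := N * (V0 * (K * B) ^+ 2 + 2 * B * (K * B)).
exists (`|Mr| + `|Mm|) => T m1 m2 m3 rho S t sol S0 E1 E2 Er V_ge0 W_ge0 tT.
pose y2 s := expR (2 / N * S s).
pose V s := second_central_moment N (m1 s) (m2 s).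
pose W s := third_central_moment N (m1 s) (m2 s) (m3 s).
pose mu s := m1 s / N.
pose psi s := expR (4 / N * S s) * (m2 s / N - (m1 s / N) ^+ 2).
(* Adding [C3 + 1] makes [H >= 1], so that the constant [eta^-2] in [yinv] is at most
   [eta^-2 * H]. *)
pose H s := expR (2 / N * S s) *
    ((m1 s / N) ^+ 2 / 2 + kap / (N - 2) * rho s + kap * cb / 2
      - (m2 s / N - (m1 s / N) ^+ 2) / 2) + (C3 + 1).
have y20 s : 0 < y2 s by exact: expR_gt0.
have psiE s : psi s = y2 s ^+ 2 * V s.
  by rewrite /psi /y2 [expR _ ^+ 2]expr2 -expRD; congr (expR _ * _); field.
have rhoE s : 0 <= s <= T -> rho s = rho0 * expR (- S s).
  by move=> sT; rewrite (moment_density sol S0 sT) Er.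
have rt s : 0 <= s <= T -> 0 < rho s.
  by move=> sT; rewrite rhoE// mulr_gt0// expR_gt0.
have psi_le s : 0 <= s <= T -> psi s <= V0.
  move=> /andP[s0 sT]; apply: (@le_trans _ _ (psi 0)).
    apply: (is_derive_le psi (fun r => - 2 * expR (4 / N * S r) * W r) 0 s s0)
        => [r /andP[r0' rs]|r /andP[r0' rs]].
      by apply: (moment_variance_derive N0 sol); rewrite r0' (le_trans rs).
    have rT : 0 <= r <= T by rewrite r0' (le_trans rs).
    have := mulr_ge0 (expR_ge0 (4 / N * S r)) (W_ge0 r rT); rewrite -/(W r); lra.
  by rewrite /psi S0 E1 E2 mulr0 expR0 mul1r ler_norm.
have psi_ge0 s : 0 <= s <= T -> 0 <= psi s.
  by move=> sT; rewrite psiE mulr_ge0 ?V_ge0// exprn_ge0// ltW.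
have yinv s : 0 <= s <= T -> (y2 s)^-1 <= eta / rho0 * (y2 s * rho s) + eta ^- 2.
  move=> sT; rewrite /y2 -expRN; apply: le_trans (expR_interpolation N (S s) eta N5 eta0 eta1) _.
  by rewrite rhoE// expRD lerD2r le_eqVlt; apply/orP; left; apply/eqP; field; rewrite gt_eqF.
have Vctrl s : 0 <= s <= T -> y2 s * (V s / 2) <= y2 s * (c1 / 2 * rho s) + C3.
  move=> sT; have pr := mulr_gt0 (y20 s) (rt s sT).
  have yi : 0 <= (y2 s)^-1 by rewrite invr_ge0 ltW.
  have -> : y2 s * (V s / 2) = psi s * (y2 s)^-1 / 2.
    by rewrite psiE; field; rewrite gt_eqF.
  have h1 := ler_wpM2r yi (psi_le s sT).
  have h2 := ler_wpM2l V00 (yinv s sT).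
  have h3 : V0 * (eta / rho0 * (y2 s * rho s)) <= c1 * (y2 s * rho s).
    have -> : V0 * (eta / rho0 * (y2 s * rho s)) = V0 * eta / rho0 * (y2 s * rho s) by ring.
    by rewrite ler_pM2r// ler_pdivrMr.
  rewrite /C3; lra.
have Hlow s : 0 <= s <= T ->
    1 + y2 s * (mu s ^+ 2 / 2) + y2 s * (c1 / 2 * rho s) <= H s.
  move=> sT; have := Vctrl s sT; have := mulr_gt0 (y20 s) (mulr_gt0 k0 c0).
  by rewrite /V /second_central_moment /H -/(y2 s) -/(mu s) -/c1; lra.
have H1 s : 0 <= s <= T -> 1 <= H s /\ y2 s * (c1 / 2 * rho s) <= H s /\
    y2 s * (mu s ^+ 2 / 2) <= H s.
  move=> sT; have := Hlow s sT; have := mulr_ge0 (ltW (y20 s)) (sqr_ge0 (mu s)).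
  by have := mulr_gt0 (y20 s) (mulr_gt0 c10 (rt s sT)) => *; do !split; lra.
have yK s : 0 <= s <= T -> (y2 s)^-1 <= K * H s.
  move=> sT; have [h1 [h2 _]] := H1 s sT; apply: (le_trans (yinv s sT)).
  have -> : K * H s = 2 * eta / (rho0 * c1) * H s + eta ^- 2 * H s by rewrite mulrDl.
  apply: lerD; last by rewrite ler_peMr// ltW.
  have -> : eta / rho0 * (y2 s * rho s) = 2 * eta / (rho0 * c1) * (y2 s * (c1 / 2 * rho s)).
    by field; rewrite !gt_eqF.
  by rewrite ler_pM2l.
pose G s := H s * expR (K / 2 * psi s).
have GD s : 0 <= s <= T -> is_derive s 1 G
    (y2 s * W s * (1 - K * H s * y2 s) * expR (K / 2 * psi s)).
  move=> sT; have N2' : N - 2 != 0 by rewrite gt_eqF.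
  have dE := moment_energy_derive N0 N2' sol sT.
  have dP := moment_variance_derive N0 sol sT.
  rewrite /G /H /psi; derive.
  have -> : expR (4 / N * S s) = y2 s ^+ 2.
    by rewrite /y2 expr2 -expRD; congr expR; field.
  rewrite -/(y2 s) -/(W s).
  by field; rewrite N2' N0.
have HB s : 0 <= s <= T -> H s <= B.
  move=> /andP[s0 sT]; have sT' : 0 <= s <= T by rewrite s0.
  have GG : G s <= G 0.
    apply: (is_derive_le G (fun r => y2 r * W r * (1 - K * H r * y2 r) *
      expR (K / 2 * psi r)) 0 s s0) => [r /andP[r0' rs]|r /andP[r0' rs]].
      by apply: GD; rewrite r0' (le_trans rs).
    have rT : 0 <= r <= T by rewrite r0' (le_trans rs).
    apply: mulr_le0_ge0; last exact: expR_ge0.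
    apply: mulr_ge0_le0; first exact: mulr_ge0 (ltW (y20 r)) (W_ge0 r rT).
    by rewrite subr_le0 -ler_pdivrMr// mul1r; exact: yK.
  have [h1 _] := H1 s sT'.
  apply: (@le_trans _ _ (G s)).
    rewrite /G ler_peMr//; first exact: le_trans h1.
    rewrite -[leLHS]expR0 ler_expR; apply: mulr_ge0; last exact: psi_ge0.
    by apply: divr_ge0 => //; exact: ltW.
  apply: (le_trans GG).
  have e0E : H 0 = e0 by rewrite /H S0 E1 E2 Er mulr0 expR0 mul1r.
  have T0 : 0 <= (0 : R) <= T by apply/andP; split; [exact: lexx|exact: le_trans sT].
  rewrite /G /B e0E; apply: ler_wpM2l.
    by rewrite -e0E; have [h _] := H1 0 T0; lra.
  by rewrite ler_expR; apply: ler_wpM2l; [lra|exact: psi_le].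
have [h1 [h2 h3]] := H1 t tT; have hB := HB t tT; have rho_t := rt t tT.
have yB : (y2 t)^-1 <= K * B by apply: le_trans (yK t tT) _; rewrite ler_pM2l.
have yi0 : 0 < (y2 t)^-1 by rewrite invr_gt0.
have B0 : 0 < B by lra.
have bound_y (v c : R) : 0 <= c -> y2 t * v <= c -> v <= c * (K * B).
  move=> c_ge0 yv; apply: (@le_trans _ _ (c / y2 t)); last exact: ler_wpM2l.
  by rewrite ler_pdivlMr// mulrC.
have rM : rho t <= Mr.
  apply: bound_y; first by apply: divr_ge0; [lra|exact: ltW].
  by rewrite ler_pdivlMr//; lra.
have muM : mu t ^+ 2 <= 2 * B * (K * B) by apply: bound_y; lra.
have VM : V t <= V0 * (K * B) ^+ 2.
  have -> : V t = psi t * (y2 t)^-1 ^+ 2 by rewrite psiE; field; rewrite gt_eqF.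
  apply: ler_pM; [exact: psi_ge0|exact: exprn_ge0 (ltW yi0)|exact: psi_le|].
  by rewrite ler_pXn2r// nnegrE ?ltW//; exact: lt_le_trans yB.
split; first by rewrite gtr0_norm// (le_trans rM)// (le_trans (ler_norm _))// lerDl.
have -> : m2 t = N * (V t + mu t ^+ 2) by rewrite /V /second_central_moment /mu; field.
apply: (@le_trans _ _ Mm); last by rewrite (le_trans (ler_norm _))// lerDr.
by rewrite ler_pM2l// lerD.
Qed.

(** * Signs of the central moments *)

Lemma is_derive_sumf {R : realType} {n : nat} {f : nat -> R -> R} {d : nat -> R} {t : R} :
  (forall i, (i < n)%N -> is_derive t 1 (f i) (d i)) ->
  is_derive t 1 (fun s => \sum_(i < n) f i s) (\sum_(i < n) d i).
Proof.
move=> fd; have := @is_derive_sum R R R n (fun i => f i) t 1 (fun i => d i) (fun i => fd i (ltn_ord i)).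
by congr (is_derive _ _ _ _); apply/funext => s; rewrite fct_sumE.
Qed.

Lemma second_central_moment_ge0 {R : realType} (n : nat) (v : nat -> R) : (0 < n)%N ->
  0 <= second_central_moment n%:R (\sum_(i < n) v i) (\sum_(i < n) v i ^+ 2).
Proof.
move=> n0; have nR : n%:R != 0 :> R by rewrite pnatr_eq0 -lt0n.
set m1 := \sum_(i < n) v i; set m2 := \sum_(i < n) _.
have : 0 <= \sum_(i < n) (v i - m1 / n%:R) ^+ 2 by apply: sumr_ge0 => i _; exact: sqr_ge0.
have -> : \sum_(i < n) (v i - m1 / n%:R) ^+ 2 = n%:R * second_central_moment n%:R m1 m2.
  rewrite (eq_bigr (fun i : 'I_n => v i ^+ 2 + (- 2 * (m1 / n%:R) * v i + (m1 / n%:R) ^+ 2)));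
    last by move=> i _; ring.
  rewrite !big_split/= -mulr_sumr sumr_const card_ord -/m1 -/m2 -[_ *+ n]mulr_natl.
  by rewrite /second_central_moment; field.
by rewrite pmulr_rge0// ltr0n.
Qed.

(* In terms of d = v - min v and tau = 2 (sum d) / n, both
   sum d (d - tau)^2 >= 0 and, as at least half of the d vanish,
   sum (d - tau)^2 >= n tau^2 / 2. *)
Lemma third_central_moment_ge0 {R : realType} (n J : nat) (v : nat -> R) :
  (0 < n)%N -> (J <= n)%N -> (n <= 2 * J)%N ->
  (forall i, (i < J)%N -> v i = v 0%N) -> (forall i, (i < n)%N -> v 0%N <= v i) ->
  0 <= third_central_moment n%:R (\sum_(i < n) v i) (\sum_(i < n) v i ^+ 2)
         (\sum_(i < n) v i ^+ 3).
Proof.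
move=> n0 Jn nJ vJ vmin; set x := v 0%N.
have nR : n%:R != 0 :> R by rewrite pnatr_eq0 -lt0n.
have ngt0 : 0 < n%:R :> R by rewrite ltr0n.
pose d i := v i - x.
pose s1 := \sum_(i < n) d i; pose s2 := \sum_(i < n) d i ^+ 2.
pose s3 := \sum_(i < n) d i ^+ 3; pose tau := 2 * s1 / n%:R.
have d0 (i : 'I_n) : 0 <= d i by rewrite subr_ge0 vmin.
have s10 : 0 <= s1 by apply: sumr_ge0 => i _; exact: d0.
have m1E : \sum_(i < n) v i = s1 + n%:R * x.
  rewrite (eq_bigr (fun i : 'I_n => d i + x)); last by move=> i _; rewrite /d subrK.
  by rewrite big_split/= sumr_const card_ord -[_ *+ n]mulr_natl.
have m2E : \sum_(i < n) v i ^+ 2 = s2 + (2 * x * s1 + n%:R * x ^+ 2).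
  rewrite (eq_bigr (fun i : 'I_n => d i ^+ 2 + (2 * x * d i + x ^+ 2)));
    last by move=> i _; rewrite /d; ring.
  by rewrite !big_split/= -mulr_sumr sumr_const card_ord -[_ *+ n]mulr_natl.
have m3E : \sum_(i < n) v i ^+ 3 =
    s3 + (3 * x * s2 + (3 * x ^+ 2 * s1 + n%:R * x ^+ 3)).
  rewrite (eq_bigr (fun i : 'I_n =>
      d i ^+ 3 + (3 * x * d i ^+ 2 + (3 * x ^+ 2 * d i + x ^+ 3))));
    last by move=> i _; rewrite /d; ring.
  by rewrite !big_split/= sumr_const card_ord -[_ *+ n]mulr_natl -!mulr_sumr.
have A : 0 <= s3 + (- 2 * tau * s2 + tau ^+ 2 * s1).
  have : 0 <= \sum_(i < n) d i * (d i - tau) ^+ 2.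
    by apply: sumr_ge0 => i _; rewrite mulr_ge0 ?sqr_ge0 ?d0.
  rewrite (eq_bigr (fun i : 'I_n => d i ^+ 3 + (- 2 * tau * d i ^+ 2 + tau ^+ 2 * d i)));
    last by move=> i _; ring.
  by rewrite !big_split/= -!mulr_sumr.
have B : n%:R / 2 * tau ^+ 2 <= s2 + (- 2 * tau * s1 + n%:R * tau ^+ 2).
  have -> : s2 + (- 2 * tau * s1 + n%:R * tau ^+ 2) = \sum_(i < n) (d i - tau) ^+ 2.
    rewrite (eq_bigr (fun i : 'I_n => d i ^+ 2 + (- 2 * tau * d i + tau ^+ 2)));
      last by move=> i _; ring.
    by rewrite !big_split/= -mulr_sumr sumr_const card_ord -[tau ^+ 2 *+ n]mulr_natl.
  apply: (@le_trans _ _ (J%:R * tau ^+ 2)).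
    rewrite ler_wpM2r ?sqr_ge0// ler_pdivrMr// -natrM ler_nat.
    by rewrite mulnC.
  rewrite (bigID (fun i : 'I_n => (i < J)%N))/= ler_wpDr//.
    by apply: sumr_ge0 => i _; exact: sqr_ge0.
  rewrite (eq_bigr (fun=> tau ^+ 2)); last first.
    by move=> i iJ; rewrite /d vJ// subrr sub0r sqrrN.
  by rewrite (big_ord_narrow Jn)/= sumr_const card_ord -[tau ^+ 2 *+ J]mulr_natl.
rewrite m1E m2E m3E /third_central_moment.
set W := (X in 0 <= X).
(* The choice of [tau] as twice the mean of the [d i] makes the third central moment a combination
   of [A] and [B] with nonnegative coefficients. *)
have -> : W = (s3 + (- 2 * tau * s2 + tau ^+ 2 * s1)) / n%:R
    + (s1 / n%:R ^+ 2) * (s2 + (- 2 * tau * s1 + n%:R * tau ^+ 2) - n%:R / 2 * tau ^+ 2).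
  by rewrite /W /tau; field.
apply: addr_ge0; first exact: divr_ge0 A (ltW ngt0).
apply: mulr_ge0; last by rewrite subr_ge0.
by apply: divr_ge0 => //; exact: exprn_ge0 (ltW ngt0).
Qed.

(** * A priori bounds for the full system *)

Definition spectral {R : realType} (n : nat) (kap cb T : R) (lam L : nat -> R -> R)
    (rho : R -> R) :=
  forall t, 0 <= t <= T ->
  (forall i, (i < n)%N -> is_derive t 1 (lam i) (- lam i t ^+ 2 + kap * (rho t - cb))
                       /\ is_derive t 1 (L i) (lam i t)) /\
  is_derive t 1 rho (- rho t * \sum_(i < n) lam i t).

Definition initially {R : realType} (n : nat) (rho0 : R) (lam0 : nat -> R)
    (lam L : nat -> R -> R) (rho : R -> R) :=
  (forall i, (i < n)%N -> L i 0 = 0 /\ lam i 0 = lam0 i) /\ rho 0 = rho0.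

(** As the forcing is the same for all indices, differences solve linear equations; equalities and
    the order among the initial speeds therefore persist. *)
Lemma spectral_gap {R : realType} {n : nat} {kap cb T : R} {lam L : nat -> R -> R}
    {rho : R -> R} {rho0 : R} {lam0 : nat -> R} {i j : nat} {t : R} :
  spectral n kap cb T lam L rho -> initially n rho0 lam0 lam L rho ->
  (i < n)%N -> (j < n)%N -> 0 <= t <= T ->
  lam i t - lam j t = (lam0 i - lam0 j) * expR (- (L i t + L j t)).
Proof.
move=> sol [ini _] ni nj /andP[t0 tT].
have [Li0 li0] := ini i ni; have [Lj0 lj0] := ini j nj.
have : (lam i t - lam j t) * expR (L i t + L j t) =
    (lam i 0 - lam j 0) * expR (L i 0 + L j 0).
  apply: (@is_derive0_const _ (fun t => (lam i t - lam j t) * expR (L i t + L j t))) => //.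
  move=> s /andP[s0 st]; have [|eqs _] := sol s; first by rewrite s0 (le_trans st).
  have [di dLi] := eqs i ni; have [dj dLj] := eqs j nj.
  derive.
  by ring.
rewrite Li0 Lj0 li0 lj0 addr0 expR0 mulr1 => <-.
by rewrite -mulrA -expRD subrr expR0 mulr1.
Qed.

Lemma spectral_moments {R : realType} {n : nat} {kap cb T : R} {lam L : nat -> R -> R}
    {rho : R -> R} :
  spectral n kap cb T lam L rho ->
  moment_system n%:R kap cb T (fun t => \sum_(i < n) lam i t)
    (fun t => \sum_(i < n) lam i t ^+ 2) (fun t => \sum_(i < n) lam i t ^+ 3) rho
    (fun t => \sum_(i < n) L i t).
Proof.
move=> sol t tT; have [eqs dr] := sol t tT; set q := kap * (rho t - cb).
split=> //.
- apply: (is_derive_eq (is_derive_sumf (fun i ni => (eqs i ni).1))).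
  by rewrite big_split/= sumr_const card_ord -[_ *+ n]mulr_natl sumrN.
- apply: (is_derive_eq (is_derive_sumf (fun i ni => is_derive_sqrf (eqs i ni).1))).
  rewrite (eq_bigr (fun i : 'I_n => - 2 * lam i t ^+ 3 + 2 * q * lam i t));
    last by move=> i _; rewrite -/q; ring.
  by rewrite big_split/= -!mulr_sumr.
- exact: is_derive_sumf (fun i ni => (eqs i ni).2).
Qed.

(** [M] is fixed before [T] and the solution; the continuation argument relies on this
    uniformity. *)
Definition apriori_bound {R : realType} (n : nat) (kap cb rho0 : R) (lam0 : nat -> R) :=
  exists M, forall T lam L rho t, spectral n kap cb T lam L rho ->
    initially n rho0 lam0 lam L rho -> 0 <= t <= T ->
    `|rho t| <= M /\ forall i, (i < n)%N -> `|lam i t| <= M.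

Lemma apriori_large {R : realType} (n J : nat) (kap cb rho0 : R) (lam0 : nat -> R) :
  (5 <= n)%N -> (J <= n)%N -> (n <= 2 * J)%N -> 0 < kap -> 0 < cb -> 0 < rho0 ->
  (forall i, (i < J)%N -> lam0 i = lam0 0%N) ->
  (forall i, (i < n)%N -> lam0 0%N <= lam0 i) ->
  apriori_bound n kap cb rho0 lam0.
Proof.
move=> n5 Jn nJ k0 c0 r0 lamJ lammin.
have n0 : (0 < n)%N by apply: leq_trans n5.
have n5R : 5 <= n%:R :> R by rewrite (ler_nat _ 5 n).
have [M MP] := moment_bounded n%:R kap cb rho0 (\sum_(i < n) lam0 i)
  (\sum_(i < n) lam0 i ^+ 2) n5R k0 c0 r0.
exists (1 + M) => T lam L rho t sol ini tT; have [ini' rE] := ini.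
have gap s i : 0 <= s <= T -> (i < n)%N ->
    lam i s - lam 0%N s = (lam0 i - lam0 0%N) * expR (- (L i s + L 0%N s)).
  by move=> sT ni; exact: spectral_gap sol ini ni n0 sT.
have [|||||||rM m2M] := MP T _ _ _ _ _ t (spectral_moments sol).
- by rewrite big1// => i _; exact: (ini' i (ltn_ord i)).1.
- by apply: eq_bigr => i _; exact: (ini' i (ltn_ord i)).2.
- by apply: eq_bigr => i _; rewrite (ini' i (ltn_ord i)).2.
- exact: rE.
- by move=> s _; exact: (second_central_moment_ge0 n (fun i => lam i s)).
- move=> s sT; apply: (third_central_moment_ge0 n J (fun i => lam i s)) => // i iJ.
    apply/eqP; rewrite -subr_eq0 gap//; last exact: leq_trans Jn.
    by rewrite lamJ// subrr mul0r.
  by rewrite -subr_ge0 gap// mulr_ge0 ?expR_ge0// subr_ge0 lammin.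
- exact: tT.
split; first by lra.
move=> i ni; apply: le_trans (normr_le_1sqr _) _; rewrite lerD2l.
apply: le_trans m2M; rewrite (bigD1 (Ordinal ni))//= lerDl.
by apply: sumr_ge0 => j _; exact: sqr_ge0.
Qed.

(** All speeds but the last stay equal by [spectral_gap], so the sum of the speeds is
    [(n - 1) x + z] and the two-speed estimates apply. *)
Lemma apriori_small {R : realType} (n : nat) (kap cb rho0 : R) (lam0 : nat -> R) :
  (2 <= n <= 4)%N -> 0 < kap -> 0 < cb -> 0 < rho0 ->
  (forall i, (i < n.-1)%N -> lam0 i = lam0 0%N) ->
  lam0 0%N <= lam0 n.-1 -> (n = 2%N -> lam0 0%N = lam0 n.-1) ->
  apriori_bound n kap cb rho0 lam0.
Proof.
move=> /andP[n2 n4] k0 c0 r0 lamJ lammin lam2.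
have [M MP] : two_speed_bound n%:R kap cb rho0 (lam0 0%N) (lam0 n.-1).
  case: n n2 n4 lamJ lammin lam2 => [|[|[|[|[|n]]]]]// _ _ _ lammin lam2.
  - by rewrite -lam2//; exact: two_speed_bounded2.
  - by apply: two_speed_bounded => //; left.
  - by apply: two_speed_bounded => //; right.
exists M => T lam L rho t sol ini tT; have [ini' rE] := ini.
have n0 : (0 < n)%N by apply: leq_trans n2.
have n1 : (n.-1 < n)%N by rewrite prednK.
have eqx s i : 0 <= s <= T -> (i < n.-1)%N -> lam i s = lam 0%N s.
  move=> sT ni; apply/eqP; rewrite -subr_eq0.
  have ni' : (i < n)%N by apply: ltn_trans ni _.
  by rewrite (spectral_gap sol ini ni' n0 sT) lamJ// subrr mul0r.
have [|xM zM rM] := MP T (lam 0%N) (lam n.-1) rho (L 0%N) (L n.-1) t _ tT.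
  have [L0 l0] := ini' 0%N n0; have [Ln ln] := ini' n.-1 n1.
  split => // s sT; have [eqs dr] := sol s sT.
  have [dx dX] := eqs 0%N n0; have [dz dZ] := eqs n.-1 n1.
  split=> //; apply: (is_derive_eq dr); congr (_ * _).
  rewrite -(big_mkord xpredT (fun i => lam i s)) -[X in \sum_(0 <= i < X) _](prednK n0).
  rewrite big_nat_recr//= big_mkord; congr (_ + _).
  rewrite (eq_bigr (fun=> lam 0%N s)); last by move=> i _; apply: eqx.
  by rewrite sumr_const card_ord -[_ *+ _]mulr_natl -subn1 natrB.
split=> // i ni; have [ni'|ni'] := ltnP i n.-1; first by rewrite eqx.
by have -> : i = n.-1 by lia.
Qed.

(** * Global existence from the a priori bound, by clamping *)

Definition clamp {R : realType} (M a : R) := Num.max (- M) (Num.min a M).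

Lemma clamp_bound {R : realType} (M a : R) : 0 <= M -> `|clamp M a| <= M.
Proof.
move=> M0; rewrite /clamp ler_norml le_max lexx/= ge_max ge_min lexx orbT andbT.
lra.
Qed.

Lemma clamp_id {R : realType} (M a : R) : `|a| <= M -> clamp M a = a.
Proof.
by rewrite ler_norml => /andP[Ma aM]; rewrite /clamp (min_idPl aM) (max_idPr Ma).
Qed.

Lemma clamp_lipschitz {R : realType} (M a b : R) : 0 <= M ->
  `|clamp M a - clamp M b| <= `|a - b|.
Proof.
move=> M0; have : - `|a - b| <= a - b <= `|a - b| by rewrite -ler_norml.
move=> /andP[h1 h2]; have h3 := normr_ge0 (a - b).
rewrite ler_norml /clamp.
by case: (leP a M) => ?; case: (leP b M) => ?;
  do 2?[case: (leP (- M) _) => ?]; apply/andP; split; lra.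
Qed.

(** The coordinates below [n] are the speeds and [ord_max] is the density, so that one vector field
    covers the system. *)
Definition clamped_field {R : realType} (n : nat) (kap cb M : R)
    (x : 'I_n.+1 -> R) (i : 'I_n.+1) : R :=
  if (i < n)%N then - clamp M (x i) ^+ 2 + kap * (clamp M (x ord_max) - cb)
  else - clamp M (x ord_max) * \sum_(j < n) clamp M (x (widen_ord (leqnSn n) j)).

Lemma clamped_field_bound {R : realType} (n : nat) (kap cb M : R) x i :
  0 <= M -> 0 <= kap -> 0 <= cb ->
  `|clamped_field n kap cb M x i| <= M ^+ 2 + kap * (M + cb) + M * (n%:R * M).
Proof.
move=> M0 k0 c0; have cl a : `|clamp M a| <= M by exact: clamp_bound.
have nM : 0 <= M * (n%:R * M) by rewrite !mulr_ge0.
have kM : 0 <= kap * (M + cb) by rewrite mulr_ge0// addr_ge0.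
have M2 : 0 <= M ^+ 2 by exact: sqr_ge0.
rewrite /clamped_field; case: ifP => _.
  apply: (@le_trans _ _ (M ^+ 2 + kap * (M + cb))); last by rewrite lerDl.
  apply: le_trans (ler_normD _ _) _; apply: lerD.
    by rewrite normrN normrX ler_pXn2r// nnegrE.
  rewrite normrM (ger0_norm k0) ler_wpM2l//.
  by apply: le_trans (ler_normB _ _) _; rewrite (ger0_norm c0) lerD2r.
apply: (@le_trans _ _ (M * (n%:R * M))); last by rewrite lerDr addr_ge0.
rewrite normrM normrN; apply: ler_pM => //.
apply: le_trans (ler_norm_sum _ _ _) _.
apply: (@le_trans _ _ (\sum_(j < n) M)); first exact: ler_sum.
by rewrite sumr_const card_ord -[M *+ n]mulr_natl.
Qed.

Lemma clamped_field_lipschitz {R : realType} (n : nat) (kap cb M : R)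
    (x y : 'I_n.+1 -> R) (c : R) :
  0 <= M -> 0 <= kap -> (forall i, `|x i - y i| <= c) ->
  forall i, `|clamped_field n kap cb M x i - clamped_field n kap cb M y i|
    <= (2 * M + kap + 2 * (n%:R * M)) * c.
Proof.
move=> M0 k0 xy i; have cl a : `|clamp M a| <= M by exact: clamp_bound.
have c0 : 0 <= c by apply: le_trans (xy i); exact: normr_ge0.
have cxy j : `|clamp M (x j) - clamp M (y j)| <= c.
  by apply: le_trans (xy j); exact: clamp_lipschitz.
have nM : 0 <= n%:R * M * c by rewrite !mulr_ge0.
have Mc : 0 <= M * c by rewrite mulr_ge0.
have kc : 0 <= kap * c by rewrite mulr_ge0.
rewrite /clamped_field; case: ifP => _.
  set a := clamp M (x i); set b := clamp M (y i).
  set r := clamp M (x ord_max); set s := clamp M (y ord_max).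
  have -> : - a ^+ 2 + kap * (r - cb) - (- b ^+ 2 + kap * (s - cb)) =
    kap * (r - s) - (a - b) * (a + b) by ring.
  apply: le_trans (ler_normB _ _) _; rewrite !normrM (ger0_norm k0).
  have h1 : kap * `|r - s| <= kap * c by rewrite ler_wpM2l// cxy.
  have h2 : `|a - b| * `|a + b| <= c * (M + M).
    by apply: ler_pM => //; [exact: cxy|apply: le_trans (ler_normD _ _) _; exact: lerD (cl _) (cl _)].
  lra.
set r := clamp M (x ord_max); set s := clamp M (y ord_max).
set A := \sum_(j < n) _; set B := \sum_(j < n) _.
have AM : `|A| <= n%:R * M.
  apply: le_trans (ler_norm_sum _ _ _) _.
  apply: (@le_trans _ _ (\sum_(j < n) M)); first exact: ler_sum.
  by rewrite sumr_const card_ord -[M *+ n]mulr_natl.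
have AB : `|A - B| <= n%:R * c.
  rewrite /A /B -sumrB; apply: le_trans (ler_norm_sum _ _ _) _.
  apply: (@le_trans _ _ (\sum_(j < n) c)); first by apply: ler_sum => j _; exact: cxy.
  by rewrite sumr_const card_ord -[c *+ n]mulr_natl.
have -> : - r * A - - s * B = - ((r - s) * A + s * (A - B)) by ring.
rewrite normrN; apply: le_trans (ler_normD _ _) _; rewrite !normrM.
have h1 : `|r - s| * `|A| <= c * (n%:R * M) by apply: ler_pM => //; exact: cxy.
have h2 : `|s| * `|A - B| <= M * (n%:R * c) by apply: ler_pM => //; exact: cl.
lra.
Qed.

(** Induction over time steps of length [1/K]. The clamped solution moves at speed at most [K], so a
    bound [M] becomes at most [M + 1] during one step. There the clamp is inactive, the original
    system holds, and the a priori bound restores [M]. *)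
Lemma apriori_global {R : realType} (n : nat) (kap cb rho0 : R) (lam0 : nat -> R) :
  0 < kap -> 0 < cb -> apriori_bound n kap cb rho0 lam0 ->
  exists lam rho L M, (forall T, spectral n kap cb T lam L rho) /\
    initially n rho0 lam0 lam L rho /\
    forall t, 0 <= t -> `|rho t| <= M /\ forall i, (i < n)%N -> `|lam i t| <= M.
Proof.
move=> k0 c0 [Map MapP].
pose x0 (i : 'I_n.+1) := if (i < n)%N then lam0 i else rho0.
(* The sum covers the initial values, for the base case of the induction. *)
pose M := `|Map| + \sum_i `|x0 i|.
have M0 : 0 <= M by rewrite addr_ge0// sumr_ge0.
have M1 : 0 <= M + 1 by lra.
pose F := clamped_field n kap cb (M + 1).
pose K := (M + 1) ^+ 2 + kap * (M + 1 + cb) + (M + 1) * (n%:R * (M + 1)).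
have FK x i : `|F x i| <= K by apply: clamped_field_bound => //; exact: ltW.
pose Lip := 2 * (M + 1) + kap + 2 * (n%:R * (M + 1)).
have nM : 0 <= n%:R * (M + 1) by rewrite mulr_ge0.
have Lip0 : 0 < Lip by rewrite /Lip; lra.
have K0 : 0 < K.
  have : 0 <= (M + 1) * (n%:R * (M + 1)) by rewrite mulr_ge0.
  have : 0 <= kap * (M + 1 + cb) by rewrite mulr_ge0 ?ltW//; lra.
  by have : 0 < (M + 1) ^+ 2 by [rewrite exprn_gt0//; lra]; rewrite /K; lra.
have [|X [X0 XD]] := lipschitz_ode_global F x0 Lip K Lip0 FK.
  by move=> x y c; apply: clamped_field_lipschitz => //; exact: ltW.
pose lam i := X (inord i); pose rho := X ord_max.
have /choice[L LP] : forall i, exists Li : R -> R, Li 0 = 0 /\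
    forall t : R, 0 <= t -> is_derive t 1 Li (lam i t).
  move=> i; apply: antiderivative => t t0.
  exact: is_derive_continuous (XD t t0 (inord i)).
have inordE i : (i < n)%N -> (inord i : 'I_n.+1) = i :> nat.
  by move=> ni; rewrite inordK// ltnS ltnW.
have ini : initially n rho0 lam0 lam L rho.
  split=> [i ni|]; last by rewrite /rho X0 /x0/= ltnn.
  by rewrite (LP i).1 /lam X0 /x0 inordE ?ni.
have speed i (s t : R) : 0 <= s -> s <= t -> `|X i t - X i s| <= K * (t - s).
  move=> s0 st; have -> : K * (t - s) = K * t - K * s by ring.
  apply: (is_derive_abs_le _ (fun r => F (fun j => X j r) i) _ (fun=> K)) => // r /andP[sr _].
  - by apply: XD; exact: le_trans sr.
  - have := is_deriveMf (is_derive_constf K r) (is_derive_id r 1).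
    by move=> /is_derive_eq; apply; rewrite mul0r add0r mulr1.
have unclamped T : (forall (t : R) i, 0 <= t <= T -> `|X i t| <= M + 1) ->
    spectral n kap cb T lam L rho.
  move=> XM t tT; have /andP[t0 _] := tT.
  have cl i : clamp (M + 1) (X i t) = X i t by apply: clamp_id; exact: XM.
  split=> [i ni|].
    split; last exact: (LP i).2.
    apply: (is_derive_eq (XD t t0 (inord i))).
    by rewrite /F /clamped_field inordE// ni !cl.
  apply: (is_derive_eq (XD t t0 ord_max)).
  rewrite /F /clamped_field ltnn cl; congr (_ * _); apply: eq_bigr => j _.
  by rewrite cl /lam; congr (X _ t); apply/val_inj; rewrite /= inordE.
have steps (j : nat) : forall (t : R) i, 0 <= t <= j%:R / K -> `|X i t| <= M.
  elim: j => [|j IH] t i.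
    rewrite mul0r => /le_anti <-; rewrite X0 /M (bigD1 i)//=.
    have : 0 <= \sum_(i0 < n.+1 | i0 != i) `|x0 i0| by exact: sumr_ge0.
    by have := normr_ge0 Map; lra.
  move=> tT.
  have sol : spectral n kap cb (j.+1%:R / K) lam L rho.
    apply: unclamped => s l /andP[s0 sT].
    have [sj|js] := leP s (j%:R / K); first by rewrite ler_wpDr// IH// s0.
    have j0 : 0 <= j%:R / K by rewrite divr_ge0// ltW.
    have := speed l _ _ j0 (ltW js).
    have : K * (s - j%:R / K) <= 1.
      have -> : K * (s - j%:R / K) = s * K - j%:R by field; rewrite gt_eqF.
      by move: sT; rewrite ler_pdivlMr// -natr1; lra.
    have : `|X l (j%:R / K)| <= M by apply: IH; rewrite j0 lexx.
    have := ler_normD (X l s - X l (j%:R / K)) (X l (j%:R / K)).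
    by rewrite subrK; lra.
  have [rM lM] := MapP _ _ _ _ _ sol ini tT.
  have MapM : Map <= M by apply: le_trans (ler_norm _) _; rewrite lerDl sumr_ge0.
  have [ni|ni] := ltnP i n.
    have -> : i = inord i :> 'I_n.+1 by apply/val_inj; rewrite /= inordE.
    exact: le_trans (lM i ni) _.
  have -> : i = ord_max by apply/val_inj/eqP; rewrite /= eqn_leq ni -ltnS ltn_ord.
  exact: le_trans rM _.
have allM (t : R) i : 0 <= t -> `|X i t| <= M.
  move=> t0; apply: (steps (Num.bound (t * K))).
  rewrite t0/= ler_pdivlMr//; apply/ltW/archi_boundP.
  by rewrite mulr_ge0// ltW.
exists lam, rho, L, M; split=> [T|].
  by apply: unclamped => t i /andP[t0 _]; rewrite ler_wpDr// allM.
by split=> // t t0; split=> [|i _]; exact: allM.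
Qed.

Theorem theorem1p3 (R : realType) (n : nat) (k cb rho0 : R)
    (lam0 : nat -> R) (J : nat) :
  (2 <= n)%N -> 0 < k -> 0 < cb -> 0 < rho0 ->
  (1 <= J)%N -> (J <= n)%N ->
  (* lam0 0 = ... = lam0 (J-1) < lam0 J <= ... <= lam0 (n-1)  (0-based) *)
  (forall i, (i.+1 < J)%N -> lam0 i = lam0 i.+1) ->
  ((J < n)%N -> lam0 J.-1 < lam0 J) ->
  (forall i, (J <= i)%N -> (i.+1 < n)%N -> lam0 i <= lam0 i.+1) ->
  ((n < 2 * J)%N \/ ((3 <= J)%N /\ n = (2 * J)%N)) ->
  exists (lam : nat -> R -> R) (rho : R -> R),
    ode_solution n k cb lam rho /\
    rho 0 = rho0 /\ (forall i, (i < n)%N -> lam i 0 = lam0 i) /\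
    exists M : R, forall t : R, 0 <= t ->
      `|rho t| <= M /\ forall i, (i < n)%N -> `|lam i t| <= M.
Proof.
move=> n2 k0 c0 r0 J1 Jn lamE lamJ lamS nJ.
have lam_eq i : (i < J)%N -> lam0 i = lam0 0%N.
  by elim: i => // i IH iJ; rewrite -lamE// IH// ltnW.
have lam_le i : (i < n)%N -> lam0 0%N <= lam0 i.
  have [iJ|Ji] := ltnP i J; first by rewrite lam_eq.
  elim: i Ji => [|i IH] Ji ni; first by [].
  have [JiE|Ji'] := eqVneq J i.+1.
    by rewrite -(lam_eq J.-1) ?prednK// -JiE; apply/ltW/lamJ; rewrite JiE.
  have Ji2 : (J <= i)%N by rewrite -ltnS ltn_neqAle Ji' Ji.
  by apply: le_trans (IH Ji2 (ltnW ni)) (lamS i Ji2 ni).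
have kn0 : 0 < k / n%:R by rewrite divr_gt0// ltr0n (leq_trans _ n2).
have ap : apriori_bound n (k / n%:R) cb rho0 lam0.
  (* For [n >= 5] only [n <= 2 J] matters. For [n <= 4] the hypothesis forces [J >= n - 1], and
     [J = n] when [n = 2]; the pair [n = 4], [J = 2] is ruled out by [3 <= J]. *)
  have [n5|n4] := leqP 5 n; first by apply: (apriori_large n J) => //; lia.
  apply: apriori_small => //; first by rewrite n2 -ltnS n4.
  - by move=> i ni; apply: lam_eq; lia.
  - by apply: lam_le; lia.
  - by move=> n2E; rewrite lam_eq//; lia.
have [lam [rho [L [M [sol [[ini rE] bnd]]]]]] := apriori_global _ _ _ _ _ kn0 c0 ap.
exists lam, rho; split; last first.
  by split=> //; split; [move=> i ni; exact: (ini i ni).2|exists M].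
have right_cont (f : R -> R) (df : R) : is_derive (0 : R) 1 f df -> (f x @[x --> 0^'+] --> f 0)%classic.
  by move=> /is_derive_continuous/cvg_at_right_filter.
(* On the degenerate interval [T = 0] the equations still give two-sided derivatives at 0, hence
   right continuity there. *)
have at0 : 0 <= (0 : R) <= 0 by rewrite lexx.
have [eqs0 dr0] := sol 0 0 at0.
split=> [t t0|]; last split=> [i ni|]; last exact: right_cont dr0.
- have [|eqs dr] := sol t t; first by rewrite ltW//= lexx.
  by split=> // i ni; exact: (eqs i ni).1.
- exact: right_cont (eqs0 i ni).1.
Qed.
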